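(* Let $\varphi:[0,\infty)\to(0,\infty)$ be continuous and strictly increasing, and let $W(x)=\exp(\varphi(|x|))$, $x\in\mathbb R$. Assume that $\lim_{|t|\to\infty} t^k/W(t)=0$ for every $k\in\mathbb N$ and that $\varphi$ is regularly growing. Let $p\in[1,\infty]$. Then: (a) if $\varphi$ is rapidly growing, there exist constants $0<c\le C$ such that for all sufficiently large $n$, $-C\,\frac{n}{\varphi^{-1}(n)}\le \log E_n(p,W)\le -c\,\frac{n}{\varphi^{-1}(n)}$; (b) if $\varphi$ is normally growing, there exist constants $0<c\le C$ such that for all sufficiently large $n$, $-C\int_0^{\varphi^{-1}(n)}\frac{\varphi(x)}{x^2+1}dx\le \log E_n(p,W)\le -c\int_0^{\varphi^{-1}(n)}\frac{\varphi(x)}{x^2+1}dx$.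
   Context: For $1\le p<\infty$, $\|f\|_{p,W}=\left(\int_{\mathbb R}|f(x)/W(x)|^p\,dx\right)^{1/p}$, and $\|f\|_{\infty,W}=\sup_{x\in\mathbb R}|f(x)/W(x)|$. Let $\mathcal P_{m}$ denote the space of complex polynomials of degree at most $m$. For $n\in\mathbb N$ and $p\in[1,\infty]$, $E_n(p,W)=\inf_{Q\in\mathcal P_{n-1}}\left\|\frac{1}{x-i}-Q(x)\right\|_{p,W}$. A continuous increasing $\varphi:\mathbb R_+\to\mathbb R_+$ satisfying $\int_0^\infty \frac{\varphi(t)}{1+t^2}dt=\infty$ is called normally growing if for some $A>0$ the function $\varphi(x)/x^2$ is decreasing on $[A,\infty)$ and $\varphi(x)$ is a convex function of $\log x$ on $[A,\infty)$; rapidly growing if for some $\varepsilon>0$ and $A>0$ the function $\varphi(x)/x^{1+\varepsilon}$ is increasing on $[A,\infty)$; regularly growing if it is normally or rapidly growing. *)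

(* Defs.v *)
From HB Require Import structures.
From mathcomp Require Import all_boot all_order all_algebra.
From mathcomp Require Import all_classical all_reals all_analysis.
From mathcomp Require Import complex.
Set Implicit Arguments. Unset Strict Implicit. Unset Printing Implicit Defensive.
Import Order.TTheory GRing.Theory Num.Theory.
Import numFieldNormedType.Exports.
Local Open Scope classical_set_scope.
Local Open Scope ring_scope.

Section Defs.
Variable R : realType.

Definition cabs (z : R[i]) : R := ComplexField.Normc.normc z.

Definition wnorm (p : \bar R) (W : R -> R) (f : R -> R[i]) : \bar R :=
  match p with
  | r%:E => poweR (\int[@lebesgue_measure R]_(x in setT)
                     ((cabs (f x) / W x) `^ r)%:E) r^-1
  | +oo%E => ereal_sup [set (cabs (f x) / W x)%:E | x in setT]
  | -oo%E => 0%E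
  end.

Definition En (n : nat) (p : \bar R) (W : R -> R) : \bar R :=
  ereal_inf [set wnorm p W (fun x => (x%:C - 'i)^-1 - Q.[x%:C])%C
            | Q in [set Q : {poly R[i]} | (size Q <= n)%N]].

Definition nonincreasing_from (A : R) (f : R -> R) : Prop :=
  forall x y, A <= x -> x <= y -> f y <= f x.
Definition nondecreasing_from (A : R) (f : R -> R) : Prop :=
  forall x y, A <= x -> x <= y -> f x <= f y.

Definition convex_from (a : R) (g : R -> R) : Prop :=
  forall s t l, a <= s -> a <= t -> 0 <= l <= 1 ->
    g (l * s + (1 - l) * t) <= l * g s + (1 - l) * g t.

Definition admissible (phi : R -> R) : Prop :=
  {within `[0, +oo[, continuous phi} /\
  nondecreasing_from 0 phi /\
  (\int[@lebesgue_measure R]_(t in `[0%R, +oo[) (phi t / (1 + t ^+ 2))%:E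
     = +oo)%E.

Definition normally_growing (phi : R -> R) : Prop :=
  admissible phi /\
  exists A : R, 0 < A /\
    nonincreasing_from A (fun x => phi x / x ^+ 2) /\
    convex_from (ln A) (fun t => phi (expR t)).

Definition rapidly_growing (phi : R -> R) : Prop :=
  admissible phi /\
  exists eps A : R, 0 < eps /\ 0 < A /\
    (forall x y, A <= x -> x < y ->
       phi x / x `^ (1 + eps) < phi y / y `^ (1 + eps)).

Definition regularly_growing (phi : R -> R) : Prop :=
  normally_growing phi \/ rapidly_growing phi.

End Defs.

(* Main.v *)
(* Writing [1 / (x - i) - Q = P / (x - i)] with [P(i) = 1] turns [E_n] into the
   problem of how large [|P(i)|] can be for a polynomial [P] of degree at most
   [n] dominated by [W]; put [a = phi^-1(n)].

   Lower bound: let [r] be a product of factors [1 - i z / s], with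
   multiplicities of order [phi (2 s)] at the dyadic scales [s] below [a] and
   of order [n] at [a].  Then [|r| >= c W] on [[-a, a]], and [|r|] dominates the
   possible growth of [P] outside, which Lagrange interpolation controls.
   As [P / (r (z + i))] is holomorphic in the upper half-plane, the Poisson
   formula at [i] bounds [|P(i)|] by [|r(i)|], and [log |r(i)|] is at most a
   constant times the sum of [phi(s) / s] over the dyadic scales.

   Upper bound: in the rapid case take a Chebyshev polynomial rescaled to
   [[-a, a]], of degree a small multiple of [n].  In the normal case take a
   product over dyadic [s] of Taylor polynomials of degree two of
   [exp (- i z / s)], the multiplicities being a small multiple of the second
   differences of [phi] along the scales, which are nonnegative by convexity.

   In the rapid case the dyadic sum is geometric, of order [n / a]; in the normal
   case it is comparable with the logarithmic integral. *)
Require Import Defs.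
From HB Require Import structures.
From mathcomp Require Import all_boot all_order all_algebra.
From mathcomp Require Import all_classical all_reals all_analysis.
From mathcomp Require Import measurable_realfun complex qpoly ring lra zify.
Import Order.TTheory GRing.Theory Num.Theory.
Import numFieldNormedType.Exports.
Local Open Scope classical_set_scope.
Local Open Scope ring_scope.

(** * Complex moduli *)

Section ComplexModulus.
Context {R : realType}.
Implicit Types (z w : R[i]) (x y : R).

(** The half-plane mean value formula is needed only for uniform limits of polynomials in the Cayley
    variable, whose powers have explicit primitives; [P / (r (z + i))] is such a limit because the
    degrees balance at infinity. The exponent [p] enters only twice: a small norm bounds a mean
    against [dt / (1 + t^2)], and a pointwise bound by [B / (1 + t^2)] bounds the norm.

    The obstacle in the lower bound is that [W] may outgrow every polynomial beyond [a]; there only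
    the degree restrains [P], whose mean on [[-a, a]] is therefore extrapolated. In the upper bound
    [P] must stay below a multiple of the square root of [W], the other half of the weight paying
    for [1 / (1 + t^2)]. Under normal growth the product has to combine degree at most [n], size at
    most a constant times [exp (phi / 2)], and a value at [i] that sees the whole dyadic sum. Second
    differences do all three: they telescope to a first difference of [phi], summation by parts
    bounds the potential they generate, and the weights [2 ^- k] turn them back into half of the
    sum. *)

Lemma cabs_ge0 z : 0 <= cabs z.
Proof. by case: z => a b; exact: sqrtr_ge0. Qed.

Lemma cabsM z w : cabs (z * w) = cabs z * cabs w.
Proof. exact: ComplexField.Normc.normcM. Qed.

Lemma cabsV z : cabs z^-1 = (cabs z)^-1.
Proof. exact: ComplexField.Normc.normcV. Qed.

Lemma cabs_real x : cabs x%:C%C = `|x|.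
Proof. by rewrite /cabs /= expr0n /= addr0 sqrtr_sqr. Qed.

Lemma cabs0 : cabs (0 : R[i]) = 0.
Proof. by rewrite -[0]/(0%:C)%C cabs_real normr0. Qed.

Lemma cabs1 : cabs (1 : R[i]) = 1.
Proof. by rewrite -[1]/(1%:C)%C cabs_real normr1. Qed.

Lemma cabsX z n : cabs (z ^+ n) = cabs z ^+ n.
Proof. by elim: n => [|n IH]; rewrite ?expr0 ?cabs1// !exprS cabsM IH. Qed.

Lemma cabsN z : cabs (- z) = cabs z.
Proof. by case: z => a b; rewrite /cabs/= !sqrrN. Qed.

Lemma cabs_eq0 z : (cabs z == 0) = (z == 0).
Proof.
apply/eqP/eqP => [|->]; last exact: cabs0.
exact: ComplexField.Normc.eq0_normc.
Qed.

Lemma cabs_normr z : `|z| = (cabs z)%:C%C.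
Proof. by case: z. Qed.

Lemma cabsD z w : cabs (z + w) <= cabs z + cabs w.
Proof. by have := ler_normD z w; rewrite !cabs_normr -rmorphD lecR. Qed.

Lemma cabsB_le z w : cabs z - cabs w <= cabs (z - w).
Proof. by have := lerB_dist z w; rewrite !cabs_normr -rmorphB lecR. Qed.

Lemma cabs_sum (I : Type) (r : seq I) (P : pred I) (F : I -> R[i]) :
  cabs (\sum_(i <- r | P i) F i) <= \sum_(i <- r | P i) cabs (F i).
Proof.
elim/big_ind2 : _ => [|z a w b za wb|//]; first by rewrite cabs0.
by apply: (le_trans (cabsD _ _)); exact: lerD.
Qed.

Lemma cabs_prod (I : Type) (r : seq I) (P : pred I) (F : I -> R[i]) :
  cabs (\prod_(i <- r | P i) F i) = \prod_(i <- r | P i) cabs (F i).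
Proof. exact: (big_morph _ cabsM cabs1). Qed.

Lemma Re_le_cabs z : complex.Re z <= cabs z.
Proof.
case: z => a b /=; rewrite /cabs/=.
apply: (le_trans (ler_norm a)); rewrite -sqrtr_sqr.
by rewrite ler_wsqrtr// lerDl sqr_ge0.
Qed.

Lemma cabs_subi x : cabs (x%:C - 'i)%C = Num.sqrt (1 + x ^+ 2).
Proof. by rewrite /cabs/= /ComplexField.Normc.normc/= subr0 sub0r sqrrN expr1n addrC. Qed.

Lemma subi_neq0 x : (x%:C - 'i)%C != 0.
Proof. by rewrite -cabs_eq0 cabs_subi gt_eqF// sqrtr_gt0 ltr_pwDl// sqr_ge0. Qed.

(** Continuity is phrased on the two real coordinates, so that only the topology of [R] is
    involved. *)
Definition ccontinuous (f : R -> R[i]) :=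
  continuous (fun x => complex.Re (f x)) /\ continuous (fun x => complex.Im (f x)).

Lemma ccontinuous_cst z : ccontinuous (fun=> z).
Proof. by split => x; exact: cvg_cst. Qed.

Lemma ccontinuous_real (g : R -> R) : continuous g -> ccontinuous (fun x => (g x)%:C%C).
Proof. by move=> cg; split => x /=; [exact: cg|exact: cvg_cst]. Qed.

Lemma ccontinuousD f g : ccontinuous f -> ccontinuous g ->
  ccontinuous (fun x => f x + g x).
Proof.
move=> [f1 f2] [g1 g2]; split => x.
  rewrite (_ : (fun _ => _) = (fun x => complex.Re (f x) + complex.Re (g x))).
    by apply: cvgD; [exact: f1|exact: g1].
  by apply/funext => y; case: (f y) (g y) => [? ?] [? ?].
rewrite (_ : (fun _ => _) = (fun x => complex.Im (f x) + complex.Im (g x))).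
  by apply: cvgD; [exact: f2|exact: g2].
by apply/funext => y; case: (f y) (g y) => [? ?] [? ?].
Qed.

Lemma ccontinuousM f g : ccontinuous f -> ccontinuous g ->
  ccontinuous (fun x => f x * g x).
Proof.
move=> [f1 f2] [g1 g2]; split => x.
  rewrite (_ : (fun _ => _) = (fun x => complex.Re (f x) * complex.Re (g x)
      - complex.Im (f x) * complex.Im (g x))).
    by apply: cvgB; apply: cvgM; [exact: f1|exact: g1|exact: f2|exact: g2].
  by apply/funext => y; case: (f y) (g y) => [? ?] [? ?].
rewrite (_ : (fun _ => _) = (fun x => complex.Re (f x) * complex.Im (g x)
    + complex.Im (f x) * complex.Re (g x))).
  by apply: cvgD; apply: cvgM; [exact: f1|exact: g2|exact: f2|exact: g1].
by apply/funext => y; case: (f y) (g y) => [? ?] [? ?].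
Qed.

Lemma ccontinuous_horner (P : {poly R[i]}) (f : R -> R[i]) :
  ccontinuous f -> ccontinuous (fun x => P.[f x]).
Proof.
move=> cf; elim/poly_ind: P => [|P c IH].
  by under eq_fun do rewrite horner0; exact: ccontinuous_cst.
under eq_fun do rewrite hornerMXaddC.
by apply: ccontinuousD; [exact: ccontinuousM|exact: ccontinuous_cst].
Qed.

Lemma continuous_cabs f : ccontinuous f -> continuous (fun x => cabs (f x)).
Proof.
move=> [f1 f2] x.
rewrite (_ : (fun _ => _) = (fun x => Num.sqrt ((complex.Re (f x)) ^+ 2 + (complex.Im (f x)) ^+ 2))).
  apply: (@continuous_comp _ _ _ (fun x => _) (@Num.sqrt R)); last exact: sqrt_continuous.
  by apply: cvgD; apply: cvgM; solve [exact: f1|exact: f2].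
by apply/funext => y; case: (f y).
Qed.

Lemma continuous_cabs_horner (P : {poly R[i]}) : continuous (fun x : R => cabs P.[x%:C%C]).
Proof.
apply: continuous_cabs; apply: ccontinuous_horner.
by apply: (@ccontinuous_real idfun) => x; exact: cvg_id.
Qed.

End ComplexModulus.

(** * The mean value property in the upper half-plane *)

Section MeanValue.
Context {R : realType}.
Notation mu := (@lebesgue_measure R).
Notation C := R[i].

Lemma oneDsqr_gt0 (t : R) : 0 < 1 + t ^+ 2.
Proof. by rewrite ltr_pwDl// sqr_ge0. Qed.

Lemma oneDsqr_neq0 (t : R) : 1 + t ^+ 2 != 0.
Proof. by rewrite gt_eqF// oneDsqr_gt0. Qed.

Lemma integral_oneDsqr : (\int[mu]_t ((1 + t ^+ 2)^-1)%:E = pi%:E)%E.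
Proof.
have := @ge0_symfun_integralT R (fun x : R => (1 + x ^+ 2)^-1).
rewrite /= => ->.
- rewrite -set_itvcy (@integral0y_oneDsqr R) -EFinM mulrC divfK//.
- by move=> x; rewrite invr_ge0 ltW// oneDsqr_gt0.
- exact: continuous_oneDsqrV.
- by move=> x; rewrite /= /oneDsqr sqrrN.
Qed.

(** The conformal map of the upper half-plane onto the unit disc that takes [i] to 0: the value at
    [i] of a polynomial in it is the constant coefficient. *)
Definition cayley (t : R) : C := ((t%:C - 'i) / (t%:C + 'i))%C.

Lemma addi_neq0 (t : R) : (t%:C + 'i)%C != 0 :> C.
Proof. by rewrite eq_complex /= add0r oner_eq0 andbF. Qed.

Lemma ccontinuous_cayley : ccontinuous cayley.
Proof.
have -> : cayley = (fun t => (((1 + t ^+ 2)^-1)%:C)%C * ((t%:C - 'i) * (t%:C - 'i))%C).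
  apply/funext => t; rewrite /cayley.
  apply: (mulIf (addi_neq0 t)); rewrite divfK ?addi_neq0//.
  rewrite -!mulrA [X in _ = _ * (_ * X)](_ : _ = ((1 + t ^+ 2)%:C)%C); last first.
    apply/eqP; rewrite eq_complex /=; apply/andP; split; apply/eqP; ring.
  rewrite mulrCA -rmorphM/= mulVf ?mulr1// oneDsqr_neq0//.
have cX : ccontinuous (fun t : R => (t%:C - 'i)%C).
  by apply: ccontinuousD; [apply: (@ccontinuous_real _ idfun) => x; exact: cvg_id|exact: ccontinuous_cst].
apply: ccontinuousM; last exact: ccontinuousM.
by apply: ccontinuous_real => x; exact: continuous_oneDsqrV.
Qed.

Lemma cabs_cayley t : cabs (cayley t) = 1.
Proof.
rewrite /cayley cabsM cabsV cabs_subi.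
rewrite (_ : cabs _ = Num.sqrt (1 + t ^+ 2)) ?divff ?gt_eqF ?sqrtr_gt0 ?oneDsqr_gt0//.
by rewrite /cabs/= /ComplexField.Normc.normc/= addr0 add0r expr1n addrC.
Qed.

(** For [theta = atan t], the numerator is [- i e^(i theta) / cos theta] and the denominator is its
    conjugate, so the quotient is [- e^(2 i theta)]. *)
Lemma cayley_trig t : cayley t = - Complex (cos (2 * atan t)) (sin (2 * atan t)).
Proof.
have h := oneDsqr_neq0 t.
have c2 : cos (atan t) ^+ 2 = (1 + t ^+ 2)^-1.
  by rewrite cos_atan exprVn sqr_sqrtr// ltW// oneDsqr_gt0.
have sE : sin (atan t) = t * cos (atan t).
  have c0 : cos (atan t) != 0.
    apply/eqP => c0; move: c2; rewrite c0 expr0n/= => /esym/eqP.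
    by rewrite invr_eq0 (negbTE h).
  by rewrite -{2}(atanK t) /tan divfK.
have -> : cos (2 * atan t) = (1 - t ^+ 2) / (1 + t ^+ 2).
  by rewrite mulrC mulr_natr mulr2n cosD -!expr2 sE exprMn c2; field.
have -> : sin (2 * atan t) = 2 * t / (1 + t ^+ 2).
  by rewrite mulrC mulr_natr mulr2n sinD sE -mulrA -c2; ring.
apply: (mulIf (addi_neq0 t)); rewrite /cayley divfK ?addi_neq0//.
by apply/eqP; rewrite eq_complex /=; apply/andP; split; apply/eqP; field.
Qed.

Lemma cayleyX t k :
  cayley t ^+ k = (-1) ^+ k * Complex (cos (2 * k%:R * atan t)) (sin (2 * k%:R * atan t)).
Proof.
elim: k => [|k IH].
  by rewrite !expr0 mulr0 mul0r cos0 sin0 mulr1.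
rewrite exprS IH cayley_trig exprS -[- Complex _ _]mulN1r.
rewrite (_ : 2 * k.+1%:R * atan t = 2 * atan t + 2 * k%:R * atan t); last first.
  by rewrite -natr1; ring.
rewrite cosD sinD mulrACA; congr (_ * _).
by apply/eqP; rewrite eq_complex /=; apply/andP; split; apply/eqP; ring.
Qed.

Lemma sin_pi_natmul k : sin (pi * k%:R) = 0 :> R.
Proof.
elim: k => [|k IH]; first by rewrite mulr0 sin0.
by rewrite -natr1 mulrDr mulr1 sinDpi IH oppr0.
Qed.

(** The improper integral is encoded by a primitive [F], so that means are computed as limits at
    infinity. Real parts are enough, because a rotation will make the value real. *)
Definition has_mean (f : R -> C) (v : C) := exists F : R -> R,
  (forall x : R, is_derive x (1 : R) F (complex.Re (f x) / (1 + x ^+ 2))) /\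
  (F L - F (- L)) @[L --> +oo] --> pi * complex.Re v.

Lemma has_meanD f g u v : has_mean f u -> has_mean g v ->
  has_mean (fun x => f x + g x) (u + v).
Proof.
move=> [F [dF cF]] [G [dG cG]]; exists (F \+ G); split.
  move=> x; have -> : complex.Re (f x + g x) = complex.Re (f x) + complex.Re (g x).
    by case: (f x) (g x) => [? ?] [? ?].
  by rewrite mulrDl; exact: is_deriveD.
have -> : complex.Re (u + v) = complex.Re u + complex.Re v.
  by case: u v {cF cG} => [? ?] [? ?].
rewrite mulrDr (_ : (fun _ => _) = (fun L => (F L - F (- L)) + (G L - G (- L)))).
  exact: cvgD.
by apply/funext => L /=; ring.
Qed.

Lemma has_mean_cst c : has_mean (fun=> c) c.
Proof.
exists (fun x => complex.Re c * atan x); split.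
  by move=> x; apply: is_deriveZ.
rewrite (_ : (fun _ => _) = (fun L => (2 * complex.Re c) * atan L)); last first.
  by apply/funext => L; rewrite atanN; ring.
rewrite (_ : pi * _ = 2 * complex.Re c * (pi / 2)); last by field.
apply: cvgM; [exact: cvg_cst|exact: cvgy_atan].
Qed.

(** The angle [theta = atan x] sweeps an interval of length [pi], on which [e^(2 i (k + 1) theta)]
    runs through [k + 1] full periods. *)
Lemma has_mean_cayleyX c k : has_mean (fun x => c * cayley x ^+ k.+1) 0.
Proof.
pose m : R := 2 * k.+1%:R.
have m0 : m != 0 by rewrite mulf_neq0// pnatr_eq0.
pose s : R := (-1) ^+ k.+1.
have sE : (-1) ^+ k.+1 = (s%:C)%C by rewrite /s rmorphXn rmorphN rmorph1.
pose F x := (s * complex.Re c / m) * sin (m * atan x) +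
            (s * complex.Im c / m) * cos (m * atan x).
exists F; split.
  move=> x.
  have d1 : is_derive x 1 (fun x => m * atan x) (m / (1 + x ^+ 2)).
    exact: is_deriveZ.
  have ds : is_derive x 1 (fun x => sin (m * atan x)) (m / (1 + x ^+ 2) * cos (m * atan x)).
    rewrite mulrC; exact: (is_derive1_comp (f := sin)).
  have dc : is_derive x 1 (fun x => cos (m * atan x)) (m / (1 + x ^+ 2) * - sin (m * atan x)).
    rewrite mulrC; exact: (is_derive1_comp (f := cos)).
  have := is_deriveD (is_deriveZ (s * complex.Re c / m) ds) (is_deriveZ (s * complex.Im c / m) dc).
  rewrite /GRing.scale /= (_ : _ + _ = complex.Re (c * cayley x ^+ k.+1) / (1 + x ^+ 2))//.
  have := oneDsqr_neq0 x => h.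
  rewrite cayleyX sE -/m; case: c {F ds dc} => a b /=.
  by field; rewrite m0 h.
(* The cosine part of the primitive is even and cancels; the sine part tends to a multiple of
   [sin (pi (k + 1)) = 0]. *)
rewrite mulr0 /F (_ : (fun _ => _) = (fun L => (2 * (s * complex.Re c / m)) * sin (m * atan L))); last first.
  by apply/funext => L; rewrite atanN mulrN sinN cosN; ring.
rewrite -(mulr0 (2 * (s * complex.Re c / m))) -(sin_pi_natmul k.+1).
rewrite (_ : pi * k.+1%:R = m * (pi / 2)); last by rewrite /m; field.
apply: cvgM; first exact: cvg_cst.
apply: (@cvg_comp _ _ _ (fun L => m * atan L) sin); last exact: continuous_sin.
by apply: cvgM; [exact: cvg_cst|exact: cvgy_atan].
Qed.

Lemma has_mean_horner_cayley (q : {poly C}) : has_mean (fun t => q.[cayley t]) q`_0.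
Proof.
suff H (c : nat -> C) n : has_mean (fun t => \sum_(i < n) c i * cayley t ^+ i)
                          (if (n > 0)%N then c 0%N else 0).
  have := H (fun i => q`_i) (size q).
  under eq_fun do rewrite -horner_coef.
  by case: ifP => // /negbT; rewrite -eqn0Ngt => /eqP h; rewrite nth_default ?h.
elim: n => [|n IH] /=.
  by under eq_fun do rewrite big_ord0; exact: has_mean_cst.
under eq_fun do rewrite big_ord_recr/=.
case: n IH => [|n] IH.
  under eq_fun do rewrite big_ord0 add0r expr0 mulr1; exact: has_mean_cst.
by rewrite -[c 0%N]addr0; apply: has_meanD => //; exact: has_mean_cayleyX.
Qed.

Lemma measurable_div_oneDsqr (g : R -> R) : continuous g ->
  measurable_fun [set: R] (EFin \o (fun t : R => g t / (1 + t ^+ 2))).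
Proof.
move=> cg; apply/measurable_EFinP; apply: continuous_measurable_fun => x.
by apply: cvgM; [exact: cg|exact: continuous_oneDsqrV].
Qed.

(** A unimodular [u] rotates the constant coefficient onto the positive axis; its modulus is then
    the mean of a real part, hence at most the mean of the modulus. *)
Lemma poly_mean_le (q : {poly C}) :
  ((pi * cabs q`_0)%:E <= \int[mu]_t ((cabs q.[cayley t] / (1 + t ^+ 2)))%:E)%E.
Proof.
set I := (\int[mu]_t _)%E.
have I0 : (0 <= I)%E.
  apply: integral_ge0 => t _; rewrite lee_fin divr_ge0 ?cabs_ge0//.
  by rewrite ltW// oneDsqr_gt0.
have [->|q0] := eqVneq q`_0 0; first by rewrite cabs0 mulr0.
pose u : C := ((cabs q`_0)%:C)%C / q`_0.
have uq : u * q`_0 = ((cabs q`_0)%:C)%C by rewrite divfK.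
have u1 : cabs u = 1.
  by rewrite cabsM cabs_real cabsV ger0_norm ?cabs_ge0// divff// cabs_eq0.
have [F [dF cF]] := has_mean_horner_cayley (u *: q).
move: cF; rewrite coefZ uq /= => cF.
have ccq : ccontinuous (fun t => q.[cayley t]) by exact: ccontinuous_horner ccontinuous_cayley.
have FI L : 0 < L -> ((F L - F (- L))%:E <= I)%E.
  move=> L0.
  pose h x := complex.Re ((u *: q).[cayley x]) / (1 + x ^+ 2).
  have ch : continuous h.
    move=> x; apply: cvgM; last exact: continuous_oneDsqrV.
    exact: (ccontinuous_horner (u *: q) _ ccontinuous_cayley).1.
  have dFx x : derivable F x 1 by exact: ex_derive.
  have cFx x : {for x, continuous F}.
    by apply/differentiable_continuous; apply/derivable1_diffP.
  rewrite EFinB -(@continuous_FTC2 _ h F (- L) L); last 4 first.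
  - by lra.
  - exact: continuous_subspaceT.
  - by split=> [x _||]; [exact: dFx|exact: cvg_at_right_filter (cFx _)|exact: cvg_at_left_filter (cFx _)].
  - by move=> x _; rewrite derive1E; exact: derive_val.
  pose g t := cabs q.[cayley t] / (1 + t ^+ 2).
  have cg : continuous g.
    by move=> x; apply: cvgM; [exact: continuous_cabs ccq _|exact: continuous_oneDsqrV].
  apply: (@le_trans _ _ (\int[mu]_(x in `[(- L)%R, L]) (g x)%:E)%E); last first.
    apply: ge0_subset_integral => //; first exact: measurable_div_oneDsqr (continuous_cabs _ ccq).
    by move=> t _; rewrite lee_fin divr_ge0 ?cabs_ge0// ltW// oneDsqr_gt0.
  apply: le_integral => //.
  - by apply: continuous_compact_integrable; [exact: segment_compact|exact: continuous_subspaceT].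
  - by apply: continuous_compact_integrable; [exact: segment_compact|exact: continuous_subspaceT].
  move=> x _; rewrite lee_fin ler_pM2r ?invr_gt0 ?oneDsqr_gt0//.
  by apply: (le_trans (Re_le_cabs _)); rewrite hornerZ cabsM u1 mul1r.
move: FI I0; case: I => [r||] // FI _; last by rewrite leey.
rewrite lee_fin leNgt; apply/negP => rlt.
have near1 : \forall L \near +oo, r < F L - F (- L) by exact: (cvgr_gt _ cF).
have near2 : \forall L \near +oo, (0 : R) < L by exact: nbhs_pinfty_gt.
have [L [h1 h2]] := filter_ex (filterI near1 near2).
by have := FI _ h2; rewrite lee_fin leNgt h1.
Qed.

(* Functions on the line that are boundary values of uniform limits of
    polynomials in the Cayley variable, [v] being the value at ['i]. *)
Definition disc_limit (f : R -> C) (v : C) := forall e : R, 0 < e ->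
  exists q : {poly C}, cabs (q`_0 - v) <= e /\ forall t, cabs (f t - q.[cayley t]) <= e.

Lemma disc_limit_le f v : ccontinuous f -> disc_limit f v ->
  ((pi * cabs v)%:E <= \int[mu]_t ((cabs (f t) / (1 + t ^+ 2)))%:E)%E.
Proof.
move=> cf fv; apply/lee_addgt0Pr => e e0.
have pi0 := @pi_gt0 R.
(* Half of [e] pays for replacing [v] by the constant coefficient of [q], half for replacing [f],
   since a constant [d] has integral [d pi] against [1 / (1 + t^2)]. *)
have [|q [q0 qf]] := fv (e / (2 * pi)); first by rewrite divr_gt0// mulr_gt0.
set d := e / (2 * pi) in q0 qf.
have d0 : 0 < d by rewrite divr_gt0// mulr_gt0.
have de : e = d * pi + d * pi.
  rewrite /d; move: (pi) (lt0r_neq0 pi0) => c c0; by field.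
have -> : e%:E = ((d * pi)%:E + (d * pi)%:E)%E by rewrite -EFinD -de.
rewrite addeA -leeBlDr//.
have s1 : ((pi * cabs v)%:E - (d * pi)%:E <= (pi * cabs q`_0)%:E)%E.
  rewrite -EFinB lee_fin.
  have : cabs v <= cabs q`_0 + d.
    rewrite -[in leLHS](subKr q`_0 v); apply: (le_trans (cabsD _ _)).
    by rewrite cabsN lerD2l.
  by nra.
apply: (le_trans s1); apply: (le_trans (poly_mean_le q)).
have mf := measurable_div_oneDsqr _ (continuous_cabs _ cf).
have md : measurable_fun [set: R] (EFin \o (fun t : R => d / (1 + t ^+ 2))).
  by apply: (measurable_div_oneDsqr (fun=> d)) => ?; exact: cvg_cst.
have <- : (\int[mu]_t (d / (1 + t ^+ 2))%:E = (d * pi)%:E)%E.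
  under eq_integral do rewrite EFinM.
  rewrite ge0_integralZl//; last 3 first.
  - by apply/measurable_EFinP; apply: continuous_measurable_fun; exact: continuous_oneDsqrV.
  - by move=> t _; rewrite lee_fin invr_ge0 ltW// oneDsqr_gt0.
  - by rewrite lee_fin ltW.
  by rewrite integral_oneDsqr.
have nn x t : 0 <= x -> (0 <= (x / (1 + t ^+ 2))%:E :> \bar R)%E.
  by move=> x0; rewrite lee_fin divr_ge0// ltW// oneDsqr_gt0.
rewrite -ge0_integralD//; last 2 first.
- by move=> t _; rewrite nn ?cabs_ge0.
- by move=> t _; rewrite nn ?ltW.
apply: ge0_le_integral => //.
- by move=> t _; rewrite nn ?cabs_ge0.
- by apply: measurable_div_oneDsqr; apply: continuous_cabs; exact: ccontinuous_horner ccontinuous_cayley.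
- exact: emeasurable_funD.
move=> t _; rewrite -EFinD lee_fin -mulrDl ler_pM2r ?invr_gt0 ?oneDsqr_gt0//.
rewrite -[in leLHS](subKr (f t) q.[_]); apply: (le_trans (cabsD _ _)).
by rewrite cabsN lerD2l.
Qed.

End MeanValue.

(** * The mean value inequality for rational functions with poles in the lower half-plane *)

Section RationalMean.
Context {R : realType}.
Notation mu := (@lebesgue_measure R).
Notation C := R[i].

Lemma disc_limit_bounded (f : R -> C) (v : C) : disc_limit f v ->
  exists2 M : R, 0 < M & cabs v <= M /\ forall t, cabs (f t) <= M.
Proof.
move=> /(_ 1 ltr01)[q [q0 qf]].
pose S := \sum_(i < size q) cabs q`_i + cabs q`_0.
have S0 : 0 <= S by rewrite addr_ge0 ?cabs_ge0// sumr_ge0// => *; rewrite cabs_ge0.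
exists (S + 1); first lra; split.
  rewrite -[v](subKr q`_0); apply: (le_trans (cabsD _ _)).
  by rewrite cabsN lerD// lerDr sumr_ge0// => *; rewrite cabs_ge0.
move=> t; rewrite -[f t](subrK q.[cayley t]) addrC; apply: (le_trans (cabsD _ _)).
rewrite lerD//; apply: (@le_trans _ _ (\sum_(i < size q) cabs q`_i)); last first.
  by rewrite lerDl cabs_ge0.
rewrite horner_coef; apply: (le_trans (cabs_sum _ _ _ _)).
by apply: ler_sum => i _; rewrite cabsM cabsX cabs_cayley expr1n mulr1.
Qed.

Lemma disc_limit_cst c : disc_limit (fun=> c : C) c.
Proof.
move=> e e0; exists c%:P; rewrite coefC/= subrr cabs0; split; first exact: ltW.
by move=> t; rewrite hornerC subrr cabs0 ltW.
Qed.

Lemma disc_limitD (f g : R -> C) u v : disc_limit f u -> disc_limit g v ->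
  disc_limit (fun t => f t + g t) (u + v).
Proof.
move=> fu gv e e0; have e20 : 0 < e / 2 by rewrite divr_gt0.
have [p [p0 pf]] := fu _ e20; have [q [q0 qg]] := gv _ e20.
exists (p + q); split.
  rewrite coefD opprD addrACA; apply: (le_trans (cabsD _ _)).
  by rewrite [e]splitr lerD.
move=> t; rewrite hornerD opprD addrACA; apply: (le_trans (cabsD _ _)).
by rewrite [e]splitr lerD.
Qed.

Lemma disc_limitM (f g : R -> C) u v : disc_limit f u -> disc_limit g v ->
  disc_limit (fun t => f t * g t) (u * v).
Proof.
move=> fu gv e e0.
have [M1 M10 [uM1 fM1]] := disc_limit_bounded _ _ fu.
have [M2 M20 [vM2 gM2]] := disc_limit_bounded _ _ gv.
(* This [d] is at most 1 and satisfies [(2 M + 1) d <= e]: one factor of the product is bounded by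
   [M], the perturbed one by [M + 1]. *)
pose M := M1 + M2; pose d := e / (2 * M + 1 + e).
have M0 : 0 < M by exact: addr_gt0.
have d0 : 0 < d by rewrite divr_gt0//; lra.
have d1 : d <= 1 by rewrite ler_pdivrMr ?mul1r; lra.
have de : (2 * M + 1) * d <= e.
  rewrite mulrA ler_pdivrMr; last lra.
  by rewrite mulrC ler_pM2l//; lra.
have key (a b a' b' : C) : cabs a <= M -> cabs b <= M -> cabs (a - a') <= d ->
    cabs (b - b') <= d -> cabs (a * b - a' * b') <= e.
  move=> aM bM aa bb.
  have b'M : cabs b' <= M + 1.
    rewrite -[b'](subKr b); apply: (le_trans (cabsD _ _)); rewrite cabsN lerD//.
    exact: le_trans bb d1.
  have -> : a * b - a' * b' = a * (b - b') + (a - a') * b' by ring.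
  apply: (le_trans (cabsD _ _)); rewrite !cabsM; apply: le_trans de.
  have := cabs_ge0 a; have := cabs_ge0 b'; have := cabs_ge0 (a - a'); have := cabs_ge0 (b - b').
  by nra.
have fM t : cabs (f t) <= M by apply: (le_trans (fM1 t)); rewrite lerDl ltW.
have gM t : cabs (g t) <= M by apply: (le_trans (gM2 t)); rewrite lerDr ltW.
have uM : cabs u <= M by apply: (le_trans uM1); rewrite lerDl ltW.
have vM : cabs v <= M by apply: (le_trans vM2); rewrite lerDr ltW.
have [p [p0 pf]] := fu _ d0; have [q [q0 qg]] := gv _ d0.
exists (p * q); split; last by move=> t; rewrite hornerM; exact: key.
rewrite coef0M -cabsN opprB; apply: key => //.
  by rewrite -cabsN opprB.
by rewrite -cabsN opprB.
Qed.

(** This is [1 / (1 - i t / b)], with its pole at [- i b]; at [t = i] its value is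
    [1 / (1 + 1 / b)]. *)
Definition lower_factor (b t : R) : C := (Complex 1 (- (t / b)))^-1.

Lemma lower_factor_neq0 (b t : R) : Complex 1 (- (t / b)) != 0.
Proof. by rewrite eq_complex/= oner_eq0. Qed.

Lemma cabs_lower_factor b t : cabs (lower_factor b t) = (Num.sqrt (1 + (t / b) ^+ 2))^-1.
Proof.
by rewrite /lower_factor cabsV /cabs/= /ComplexField.Normc.normc/= sqrrN expr1n.
Qed.

Lemma ccontinuous_lower_factor b : ccontinuous (lower_factor b).
Proof.
have ch : continuous (fun t : R => (1 + (t / b) ^+ 2)^-1).
  move=> t; apply: cvgV; first exact: oneDsqr_neq0.
  have cd : (x / b) @[x --> t] --> t / b by apply: cvgM; [exact: cvg_id|exact: cvg_cst].
  by apply: cvgD; [exact: cvg_cst|apply: cvgM].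
split => t.
  rewrite (_ : (fun _ => _) = (fun t : R => (1 + (t / b) ^+ 2)^-1)); first exact: ch.
  by apply/funext => x; rewrite /= expr1n sqrrN mul1r.
rewrite (_ : (fun _ => _) = (fun t : R => (t / b) * (1 + (t / b) ^+ 2)^-1)).
  by apply: cvgM; [apply: cvgM; [exact: cvg_id|exact: cvg_cst]|exact: ch].
by apply/funext => x; rewrite /= expr1n sqrrN mulNr opprK.
Qed.

(* [1 / (1 - i t / b) = b / (b + 1) * (1 - w) / (1 - beta w)] in the Cayley
   variable [w], with [beta = (b - 1) / (b + 1)] of modulus less than one. *)
Lemma disc_limit_lower_factor b : 0 < b ->
  disc_limit (lower_factor b) (((1 + b^-1)^-1)%:C)%C.
Proof.
move=> b0 e e0.
pose beta : R := (b - 1) / (b + 1); pose c : R := b / (b + 1).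
have b10 : b + 1 != 0 by lra.
have beta1 : `|beta| < 1.
  rewrite normrM normfV [X in _ / X]gtr0_norm; last lra.
  by rewrite ltr_pdivrMr ?mul1r; last lra; rewrite ltr_norml; lra.
have [N bN] : exists N, `|beta| ^+ N.+1 <= e.
  have : `|beta| ^+ n @[n --> \oo] --> 0 by apply: cvg_expr; rewrite normr_id.
  move/cvgrPdist_le/(_ e e0) => [n _ /(_ n.+1)] /=.
  rewrite sub0r normrN normrX normr_id => h; exists n; apply: h.
  by rewrite /= ltnW.
(* Truncated geometric series: the error is [lower_factor b t], of modulus at most 1, times
   [(beta w)^(N + 1)]. *)
pose q : {poly C} := (c%:C)%C%:P * (1 - 'X) * \sum_(k < N.+1) ((beta%:C)%C%:P * 'X) ^+ k.
exists q; split.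
  rewrite -horner_coef0 /q !hornerM !hornerE horner_sum big_ord_recl/=.
  rewrite expr0 hornerC big1 => [|i _]; last first.
    by rewrite horner_exp hornerM hornerC hornerX mulr0 expr0n.
  rewrite (_ : _ - _ = 0) ?cabs0 ?ltW//.
  rewrite subr0 addr0 !mulr1; apply/eqP; rewrite subr_eq0 eq_complex/= eqxx andbT.
  apply/eqP; rewrite /c; field.
  by rewrite (gt_eqF b0) b10.
move=> t; set w := cayley t.
have qw : q.[w] = lower_factor b t * (1 - ((beta%:C)%C * w) ^+ N.+1).
  have -> : q.[w] = (c%:C)%C * (1 - w) * \sum_(k < N.+1) ((beta%:C)%C * w) ^+ k.
    rewrite /q !hornerM !hornerE horner_sum; congr (_ * _).
    by apply: eq_bigr => i _; rewrite horner_exp !hornerE.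
  have -> : 1 - ((beta%:C)%C * w) ^+ N.+1 =
      (1 - (beta%:C)%C * w) * \sum_(k < N.+1) ((beta%:C)%C * w) ^+ k.
    rewrite -[LHS]opprB subrX1 -mulNr opprB; congr (_ * _).
  rewrite [RHS]mulrA; congr (_ * _).
  rewrite /w /cayley /lower_factor.
  have D0 := lower_factor_neq0 b t; have T0 := addi_neq0 t.
  have key : ((t%:C + 'i) - beta%:C * (t%:C - 'i))%C =
     Complex 1 (- (t / b)) * ((c%:C)%C * ((t%:C + 'i) - (t%:C - 'i))%C).
    apply/eqP; rewrite eq_complex/=; apply/andP; split; apply/eqP; rewrite /beta /c; field.
      by rewrite (gt_eqF b0) b10.
    by rewrite (gt_eqF b0) b10.
  move: (t%:C + 'i)%C (t%:C - 'i)%C (Complex 1 _) T0 D0 key => T S D T0 D0 key.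
  apply: (mulIf T0); apply: (mulfI D0).

  have -> : D * (D^-1 * (1 - (beta%:C)%C * (S / T)) * T) = T - (beta%:C)%C * S.
    by field; rewrite D0 T0.
  by rewrite key; field.
rewrite qw mulrBr mulr1 opprB addrC subrK cabsM cabsX cabsM cabs_cayley mulr1.
rewrite cabs_lower_factor cabs_real; apply: le_trans bN.
rewrite ler_piMl ?exprn_ge0// invf_le1 ?sqrtr_gt0 ?oneDsqr_gt0//.
by rewrite -[leLHS]sqrtr1 ler_wsqrtr// lerDl sqr_ge0.
Qed.

(** Each degree of [P] consumes one factor of the denominator, because [t] alone is unbounded
    whereas [t * lower_factor b t] is still a uniform limit. *)
Lemma disc_limit_ratio (bs : seq R) (P : {poly C}) :
  (forall b, b \in bs -> 0 < b) -> (size P <= (size bs).+1)%N ->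
  disc_limit (fun t => P.[(t%:C)%C] * \prod_(b <- bs) lower_factor b t)
             (P.['i%C] * \prod_(b <- bs) ((1 + b^-1)^-1)%:C%C).
Proof.
elim: bs P => [|b bs IH] P bs0 sP.
  have [c ->] : exists c, P = c%:P by exists P`_0; exact: size1_polyC.
  rewrite big_nil mulr1 hornerC (_ : (fun _ => _) = fun=> c); first exact: disc_limit_cst.
  by apply/funext => t; rewrite big_nil mulr1 hornerC.
have b0 : 0 < b by rewrite bs0// mem_head.
have bs0' x : x \in bs -> 0 < x by move=> xbs; rewrite bs0// in_cons xbs orbT.
have db := disc_limit_lower_factor b b0.
(* Rests on [t / (1 - i t / b) = i b - i b / (1 - i t / b)]. *)
have dtb : disc_limit (fun t => (t%:C)%C * lower_factor b t) ('i%C * ((1 + b^-1)^-1)%:C%C).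
  have -> : 'i%C * ((1 + b^-1)^-1)%:C%C = Complex 0 b + Complex 0 (- b) * ((1 + b^-1)^-1)%:C%C :> C.
    have h : b + 1 != 0 by lra.
    apply/eqP; rewrite eq_complex/=; apply/andP; split; apply/eqP; first by ring.
    by field; rewrite (gt_eqF b0) h.
  have -> : (fun t => (t%:C)%C * lower_factor b t) =
      (fun t => Complex 0 b + Complex 0 (- b) * lower_factor b t).
    apply/funext => t; apply: (mulIf (lower_factor_neq0 b t)).
    rewrite mulrDl -!mulrA mulVf ?lower_factor_neq0// !mulr1.
    apply/eqP; rewrite eq_complex/=; apply/andP; split; apply/eqP; field; exact: lt0r_neq0.
  apply: disc_limitD; first exact: disc_limit_cst.
  by apply: disc_limitM => //; exact: disc_limit_cst.
(* A case split rather than an induction: the indeterminate is paired with the factor [b], and the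
   constant [c] multiplies the product of all factors, obtained from [IH] for the polynomial 1. *)
elim/poly_ind: P sP => [|P c _] sP.
  rewrite horner0 mul0r (_ : (fun _ => _) = fun=> 0); first exact: disc_limit_cst.
  by apply/funext => t; rewrite horner0 mul0r.
have sP' : (size P <= (size bs).+1)%N.
  by move: sP; rewrite size_MXaddC; case: ifP => // /andP[/eqP-> _]; rewrite size_poly0.
have h1 := disc_limitM _ _ _ _ (IH P bs0' sP') dtb.
have h2 := disc_limitM _ _ _ _ (disc_limit_cst c)
  (disc_limitM _ _ _ _ (IH 1 bs0' (leq_trans (size_polyC_leq1 _) (ltn0Sn _))) db).
have := disc_limitD _ _ _ _ h1 h2.
set f := (fun _ => _); set u := _ + _.
rewrite (_ : f = fun t => (P * 'X + c%:P).[(t%:C)%C] * \prod_(j <- b :: bs) lower_factor j t).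
  rewrite (_ : u = (P * 'X + c%:P).['i%C] * \prod_(j <- b :: bs) ((1 + j^-1)^-1)%:C%C)//.
  by rewrite big_cons hornerMXaddC /u hornerC mul1r; ring.
by apply/funext => t; rewrite big_cons hornerMXaddC /f hornerC mul1r; ring.
Qed.

Lemma ratio_mean_le (bs : seq R) (P : {poly C}) :
  (forall b, b \in bs -> 0 < b) -> (size P <= (size bs).+1)%N ->
  ((pi * (cabs P.['i%C] / \prod_(b <- bs) (1 + b^-1)))%:E <=
   \int[mu]_t (cabs P.[(t%:C)%C] / \prod_(b <- bs) Num.sqrt (1 + (t / b) ^+ 2)
                 / (1 + t ^+ 2))%:E)%E.
Proof.
move=> bs0 sP.
have := disc_limit_le _ _ _ (disc_limit_ratio bs P bs0 sP).
rewrite cabsM cabs_prod.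
have -> : \prod_(b <- bs) cabs ((1 + b^-1)^-1)%:C%C = (\prod_(b <- bs) (1 + b^-1))^-1.
  rewrite -prodfV; apply: eq_big_seq => b /bs0 b0.
  by rewrite cabs_real ger0_norm// invr_ge0 addr_ge0// invr_ge0 ltW.
under eq_integral.
  move=> t _; rewrite cabsM cabs_prod.
  under eq_bigr do rewrite cabs_lower_factor.
  rewrite prodfV; over.
apply; apply: ccontinuousM.
  by apply: ccontinuous_horner; apply: (@ccontinuous_real _ idfun) => x; exact: cvg_id.
elim: bs {bs0 sP} => [|b bs IH].
  by rewrite (_ : (fun _ => _) = fun=> 1); [exact: ccontinuous_cst|apply/funext => t; rewrite big_nil].
rewrite (_ : (fun _ => _) = fun t => lower_factor b t * \prod_(j <- bs) lower_factor j t); last first.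
  by apply/funext => t; rewrite big_cons.
by apply: ccontinuousM => //; exact: ccontinuous_lower_factor.
Qed.

End RationalMean.

(** * Weighted norms *)

Section WeightedNorm.
Context {R : realType}.
Notation mu := (@lebesgue_measure R).
Notation C := R[i].
Variable W : R -> R.
Hypotheses (W_gt0 : forall t, 0 < W t) (W_cont : continuous W).

Lemma continuous_cabs_div f : ccontinuous f -> continuous (fun t => cabs (f t) / W t).
Proof.
move=> cf t; apply: cvgM; first exact: continuous_cabs.
by apply: cvgV; [rewrite gt_eqF|exact: W_cont].
Qed.

Lemma le_one_add_powR (x r : R) : 0 <= x -> 1 <= r -> x <= 1 + x `^ r.
Proof.
move=> x0 r1; have [x1|x1] := leP x 1.
  by rewrite (le_trans x1)// lerDl powR_ge0.
rewrite -[leLHS]powRr1//; apply: (@le_trans _ _ (x `^ r)); last by rewrite lerDr.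
by rewrite ler_powR// ltW.
Qed.

(** A substitute for the Hoelder inequality: with [g = |f| / W], pointwise [g <= k + k^(1 - r) g^r].
    Against [1 / (1 + t^2)], itself at most 1, the first term gives [k pi] and the second at most
    [k], for every finite exponent [r]. *)
Lemma wnorm_mean_le (p : \bar R) (f : R -> C) (k : R) :
  (1 <= p)%E -> 0 < k -> ccontinuous f -> (wnorm p W f <= k%:E)%E ->
  (\int[mu]_t (cabs (f t) / W t / (1 + t ^+ 2))%:E <= (k * (pi + 1))%:E)%E.
Proof.
move=> p1 k0 cf; have cg := continuous_cabs_div _ cf.
pose g t := cabs (f t) / W t.
have g0 t : 0 <= g t by rewrite divr_ge0 ?cabs_ge0// ltW.
have nn x (t : R) : 0 <= x -> (0 <= (x / (1 + t ^+ 2))%:E :> \bar R)%E.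
  by move=> x0; rewrite lee_fin divr_ge0// ltW// oneDsqr_gt0.
have mk : measurable_fun [set: R] (fun t : R => (k / (1 + t ^+ 2))%:E).
  by apply: (measurable_div_oneDsqr (fun=> k)) => ?; exact: cvg_cst.
have Ik : (\int[mu]_t (k / (1 + t ^+ 2))%:E = (k * pi)%:E)%E.
  under eq_integral do rewrite EFinM.
  rewrite ge0_integralZl//; last 3 first.
  - by apply/measurable_EFinP; apply: continuous_measurable_fun; exact: continuous_oneDsqrV.
  - by move=> t _; rewrite lee_fin invr_ge0 ltW// oneDsqr_gt0.
  - by rewrite lee_fin ltW.
  by rewrite integral_oneDsqr.
have mg := measurable_div_oneDsqr _ cg.
case: p p1 => [r| |//]; last first.
  move=> _ /= wk.
  apply: (@le_trans _ _ (\int[mu]_t (k / (1 + t ^+ 2))%:E)%E).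
    apply: ge0_le_integral => //; first by move=> t _; apply: nn; exact: g0.
    move=> t _; rewrite lee_fin ler_pM2r ?invr_gt0 ?oneDsqr_gt0//.
    by rewrite -lee_fin; apply: le_trans wk; apply: ereal_sup_ubound; exists t.
  by rewrite Ik lee_fin ler_pM2l// lerDl.
rewrite lee_fin => r1 /=.
have r0 : 0 < r by lra.
set I := (\int[mu]_(x in _) _)%E.
have I0 : (0 <= I)%E by apply: integral_ge0 => t _; rewrite lee_fin powR_ge0.
move=> wk.
have Ile : (I <= (k `^ r)%:E)%E.
  move: I0 wk; case: I => [x||]//=; last by rewrite invr_eq0 gt_eqF.
  rewrite !lee_fin => x0 xk.
  rewrite -[x](powRr1)// -(@mulVf _ r) ?gt_eqF// powRrM.
  by rewrite ge0_ler_powR ?nnegrE ?powR_ge0// ltW.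
have mgr : measurable_fun [set: R] (fun t : R => (g t `^ r)%:E).
  apply/measurable_EFinP.
  exact: (measurableT_comp (@measurable_powR R r) (continuous_measurable_fun cg)).
have c0 : 0 <= k / k `^ r by rewrite divr_ge0 ?powR_ge0// ltW.
apply: (@le_trans _ _ (\int[mu]_t ((k / (1 + t ^+ 2))%:E + (k / k `^ r)%:E * (g t `^ r)%:E))%E).
  apply: ge0_le_integral => //.
  - by move=> t _; apply: nn; exact: g0.
  - by apply: emeasurable_funD => //; exact: measurable_funeM.
  move=> t _; rewrite -EFinM -EFinD lee_fin.
  have u0 : 0 <= (1 + t ^+ 2)^-1 by rewrite invr_ge0 ltW// oneDsqr_gt0.
  have u1 : (1 + t ^+ 2)^-1 <= 1 by rewrite invf_le1 ?oneDsqr_gt0// lerDl sqr_ge0.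
  have gk : g t <= k + k / k `^ r * (g t `^ r).
    have := @le_one_add_powR (g t / k) r (divr_ge0 (g0 t) (ltW k0)) r1.
    rewrite powRM ?invr_ge0// ?(ltW k0)// ler_pdivrMr// => /le_trans; apply.
    have -> : k^-1 `^ r = (k `^ r)^-1.
      by rewrite -powR_inv1 ?(ltW k0)// -powRrM mulN1r powRN.
    by rewrite le_eqVlt; apply/orP; left; apply/eqP; ring.
  apply: (le_trans (ler_wpM2r u0 gk)); rewrite mulrDl lerD2l ler_piMr//.
  by rewrite mulr_ge0// powR_ge0.
rewrite ge0_integralD//; last 3 first.
- by move=> t _; rewrite nn// ltW.
- by move=> t _; rewrite -EFinM lee_fin mulr_ge0// powR_ge0.
- exact: measurable_funeM.
rewrite Ik ge0_integralZl// ?lee_fin//; last first.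
  by move=> t _; rewrite lee_fin powR_ge0.
rewrite (mulrDr k pi 1) mulr1 EFinD leeD2l//.
have c0e : (0%:E <= (k / k `^ r)%:E)%E by rewrite lee_fin.
apply: (le_trans (lee_wpmul2l c0e Ile)).
by rewrite -EFinM lee_fin divfK// gt_eqF// powR_gt0.
Qed.

(** The constant 4 absorbs [pi] uniformly in the exponent: [(1 + t^2)^(- r) <= 1 / (1 + t^2)] and
    [pi <= 4 <= 4^r]. *)
Lemma wnorm_le (p : \bar R) (f : R -> C) (B : R) :
  (1 <= p)%E -> 0 < B -> ccontinuous f ->
  (forall t, cabs (f t) / W t <= B / (1 + t ^+ 2)) -> (wnorm p W f <= (4 * B)%:E)%E.
Proof.
move=> p1 B0 cf fB; have cg := continuous_cabs_div _ cf.
pose g t := cabs (f t) / W t.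
have g0 t : 0 <= g t by rewrite divr_ge0 ?cabs_ge0// ltW.
have u0 (t : R) : 0 <= (1 + t ^+ 2)^-1 by rewrite invr_ge0 ltW// oneDsqr_gt0.
have u1 (t : R) : (1 + t ^+ 2)^-1 <= 1 by rewrite invf_le1 ?oneDsqr_gt0// lerDl sqr_ge0.
case: p p1 => [r| |//]; last first.
  move=> _ /=; apply: ge_ereal_sup => _ [t _ <-]; rewrite lee_fin.
  by apply: (le_trans (fB t)); have := u1 t; have := u0 t; nra.
rewrite lee_fin => r1 /=.
have r0 : 0 < r by lra.
have mg : measurable_fun [set: R] g by exact: continuous_measurable_fun.
have mgr : measurable_fun [set: R] (fun t : R => (g t `^ r)%:E).
  apply/measurable_EFinP.
  exact: (measurableT_comp (@measurable_powR R r) mg).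
have mu1 : measurable_fun [set: R] (fun t : R => ((1 + t ^+ 2)^-1)%:E).
  by apply/measurable_EFinP; apply: continuous_measurable_fun; exact: continuous_oneDsqrV.
have Ile : (\int[mu]_t (g t `^ r)%:E <= ((4 * B) `^ r)%:E)%E.
  apply: (@le_trans _ _ (\int[mu]_t ((B `^ r)%:E * ((1 + t ^+ 2)^-1)%:E))%E).
    apply: ge0_le_integral => //.
    - by move=> t _; rewrite lee_fin powR_ge0.
    - exact: measurable_funeM.
    move=> t _; rewrite -EFinM lee_fin.
    apply: (@le_trans _ _ ((B / (1 + t ^+ 2)) `^ r)).
      have h1 : g t \is Num.nneg by rewrite nnegrE; exact: g0.
      have h2 : B / (1 + t ^+ 2) \is Num.nneg by rewrite nnegrE mulr_ge0// ltW.
      exact: (ge0_ler_powR (ltW r0) h1 h2 (fB t)).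
    rewrite powRM// ?(ltW B0)// ler_wpM2l ?powR_ge0//.
    by apply: ge1r_powR => //; rewrite invr_gt0 oneDsqr_gt0 u1.
  rewrite ge0_integralZl//; last 2 first.
  - by move=> t _; rewrite lee_fin.
  - by rewrite lee_fin powR_ge0.
  rewrite integral_oneDsqr -EFinM lee_fin powRM// ?(ltW B0)// mulrC ler_wpM2r ?powR_ge0//.
  apply: (@le_trans _ _ 4); last by rewrite -[leLHS]powRr1// ler_powR//; lra.
  have := @pihalf_lt2 R; lra.
apply: (@le_trans _ _ (poweR ((4 * B) `^ r)%:E r^-1)).
  apply: gt0_ler_poweR => //; rewrite ?invr_ge0 ?(ltW r0)//.
  - rewrite in_itv/= leey andbT; apply: integral_ge0 => t _; rewrite lee_fin powR_ge0//.
  - by rewrite in_itv/= leey andbT lee_fin powR_ge0.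
by rewrite /= lee_fin -powRrM divff ?gt_eqF// powRr1// mulr_ge0// ltW.
Qed.

Lemma ccontinuous_horner_div (P : {poly C}) :
  ccontinuous (fun x : R => P.[(x%:C)%C] / (x%:C - 'i)%C).
Proof.
apply: ccontinuousM.
  by apply: ccontinuous_horner; apply: (@ccontinuous_real _ idfun) => x; exact: cvg_id.
rewrite (_ : (fun _ => _) = fun t : R => (((1 + t ^+ 2)^-1)%:C)%C * (t%:C + 'i)%C).
  apply: ccontinuousM; first by apply: ccontinuous_real => x; exact: continuous_oneDsqrV.
  by apply: ccontinuousD; [apply: (@ccontinuous_real _ idfun) => x; exact: cvg_id|exact: ccontinuous_cst].
apply/funext => t; apply: (mulIf (subi_neq0 t)); rewrite mulVf ?subi_neq0// -mulrA.
apply/eqP; rewrite eq_complex/=; apply/andP; split; apply/eqP; field; exact: oneDsqr_neq0.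
Qed.

(* [1 / (x - i) - Q = P / (x - i)] with [P = 1 - (x - i) Q], so that [P(i) = 1]. *)
Lemma En_ge (n : nat) (p : \bar R) (k : \bar R) :
  (forall P : {poly C}, (size P <= n.+1)%N -> P.['i%C] = 1 ->
     (k <= wnorm p W (fun x : R => (P.[(x%:C)%C] / (x%:C - 'i)%C)%R))%E) ->
  (k <= En n p W)%E.
Proof.
move=> kP; apply: le_ereal_inf_tmp => _ [Q /= sQ <-].
have := kP (1 - ('X - 'i%C%:P) * Q).
rewrite (_ : (fun x : R => _ / _) = (fun x : R => (x%:C - 'i)^-1 - Q.[x%:C])%C).
  apply; last by rewrite !hornerE subrr mul0r subr0.
  rewrite (leq_trans (size_polyD _ _))// geq_max size_polyN size_poly1/=.
  by rewrite (leq_trans (size_polyMleq _ _))// size_XsubC/=.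
by apply/funext => x; rewrite !hornerE mulrBl mulrAC divff ?subi_neq0// !mul1r.
Qed.

(** As [1 - P / P(i)] vanishes at [i], it is [(x - i) Q], and the error of this [Q] is
    [P / (P(i) (x - i))]; the factor [1 / |x - i| <= 1] is dropped. *)
Lemma En_le (n : nat) (p : \bar R) (P : {poly C}) (B : R) :
  (1 <= p)%E -> 0 < B -> (size P <= n.+1)%N -> P.['i%C] != 0 ->
  (forall t : R, cabs P.[(t%:C)%C] / W t <= B / (1 + t ^+ 2)) ->
  (En n p W <= (4 * (B / cabs P.['i%C]))%:E)%E.
Proof.
move=> p1 B0 sP Pi0 PB.
have : root (1 - (P.['i%C])^-1 *: P) ('i%C) by rewrite /root !hornerE mulVf// subrr.
move=> /factor_theorem[Q QE].
have sQ : (size Q <= n)%N.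
  have [->|Q0] := eqVneq Q 0; first by rewrite size_poly0.
  have := congr1 (fun q : {poly C} => size q) QE.
  rewrite size_Mmonic ?monicXsubC// size_XsubC addn2/= => sE.
  rewrite -ltnS -sE (leq_trans (size_polyD _ _))// geq_max size_poly1/= size_polyN.
  by rewrite (leq_trans (size_scale_leq _ _)).
pose f (x : R) := (P.['i%C])^-1 * (P.[(x%:C)%C] / (x%:C - 'i)%C).
have fE : f = (fun x : R => (x%:C - 'i)^-1 - Q.[x%:C])%C.
  apply/funext => x; rewrite /f.
  have := congr1 (fun q => q.[(x%:C)%C]) QE; rewrite !hornerE => h.
  apply: (mulIf (subi_neq0 x)).
  rewrite mulrBl mulVf ?subi_neq0// -h -!mulrA mulVf ?subi_neq0// mulr1; ring.
apply: (@le_trans _ _ (wnorm p W f)).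
  by apply: ereal_inf_lbound; exists Q => //; rewrite fE.
have ci0 : 0 < cabs P.['i%C] by rewrite lt_neqAle cabs_ge0 andbT eq_sym cabs_eq0.
apply: wnorm_le => //; first exact: divr_gt0.
  by apply: ccontinuousM; [exact: ccontinuous_cst|exact: ccontinuous_horner_div].
move=> t; rewrite /f !cabsM !cabsV cabs_subi.
set c := cabs P.['i%C] in ci0 *; set X := cabs P.[(t%:C)%C]; set s := Num.sqrt _.
have -> : c^-1 * (X / s) / W t = (X / W t / c) * s^-1 by ring.
have -> : B / c / (1 + t ^+ 2) = B / (1 + t ^+ 2) / c by ring.
apply: (@le_trans _ _ (X / W t / c)); last by rewrite ler_pM2r ?invr_gt0// PB.
apply: ler_piMr; first by rewrite !mulr_ge0 ?invr_ge0 ?cabs_ge0// ltW.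
by rewrite invf_le1 ?sqrtr_gt0 ?oneDsqr_gt0// -[leLHS]sqrtr1 ler_wsqrtr// lerDl sqr_ge0.
Qed.

End WeightedNorm.

(** * Extrapolation outside an interval *)

(** Truncated subtraction makes [(i - j) + (j - i)] the distance of [i] and [j]; this is the modulus
    of the denominator of a Lagrange basis polynomial at the nodes [0, ..., n]. *)
Lemma prod_dist_ord (n : nat) (i : nat) : (i <= n)%N ->
  (\prod_(0 <= j < n.+1 | j != i) ((i - j) + (j - i)) = i`! * (n - i)`!)%N.
Proof.
elim: n => [|n IH]; rewrite leq_eqVlt => /orP[/eqP ->|].
- by rewrite big_mkcond big_nat1.
- by [].
- rewrite subnn fact0 muln1 big_mkcond big_nat_recr//= eqxx muln1.
  rewrite fact_prod big_add1/= big_nat_rev/= big_nat [RHS]big_nat.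
  apply: eq_bigr => j /andP[_ jn]; rewrite add0n; case: ifPn => [_|]; last first.
    by rewrite negbK => /eqP; lia.
  by lia.
- rewrite ltnS => i_n; rewrite big_mkcond big_nat_recr//= -big_mkcond/= IH//.
  by rewrite ifT ?subSn// ?factS; lia.
Qed.

Lemma bin_le_exp2 n i : ('C(n, i) <= 2 ^ n)%N.
Proof.
case: (leqP i n) => [i_n|n_i]; last by rewrite bin_small.
rewrite -[2%N]/(1 + 1)%N expnDn (bigD1 (Ordinal (i_n : (i < n.+1)%N)))//=.
by rewrite !exp1n !muln1 leq_addr.
Qed.

Section Extrapolation.
Context {R : realType}.
Notation mu := (@lebesgue_measure R).
Notation C := R[i].

(* Lagrange interpolation at nodes chosen in every other one of [2n+1] equal
   intervals, each node minimizing [|P|] on its interval. *)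
Lemma poly_extrapolation (P : {poly C}) (n : nat) (a X t : R) :
  (size P <= n.+1)%N -> 0 < a -> a <= `|t| ->
  (\int[mu]_(x in `[(- a)%R, a]) (cabs P.[(x%:C)%C])%:E <= X%:E)%E ->
  cabs P.[(t%:C)%C] <= X / a * expR 1 * (16 * expR 1 * (`|t| / a)) ^+ n.
Proof.
move=> sP a0 at_ IX.
have t0 : 0 < `|t| by exact: lt_le_trans a0 at_.
pose h : R := a / n.+1%:R.
have h0 : 0 < h by rewrite divr_gt0.
pose c (j : nat) : R := - a + 2 * j%:R * h.
have cP := @continuous_cabs_horner R P.
have /boolp.choice[x xP] (j : nat) : exists y : R,
    c j <= y <= c j + h /\ forall s, c j <= s <= c j + h -> cabs P.[(y%:C)%C] <= cabs P.[(s%:C)%C].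
  have [||y yI ymin] := @EVT_min R (fun s => cabs P.[(s%:C)%C]) (c j) (c j + h).
  - by rewrite lerDl ltW.
  - exact: continuous_subspaceT.
  by exists y; split => [|s sI]; [rewrite in_itv/= in yI|apply: ymin; rewrite in_itv].
(* Left ends are [2 (j - i) h] apart and each node is within [h] of its own, which leaves
   [(2 (j - i) - 1) h >= (j - i) h]. *)
have dist (i j : nat) : (i < j)%N -> (j - i)%:R * h <= x j - x i.
  move=> ij; have [/andP[_ xi] _] := xP i; have [/andP[xj _] _] := xP j.
  have ji : (1 : R) <= (j - i)%:R by rewrite ler1n subn_gt0.
  rewrite (_ : x j = c j + (x j - c j)); last by ring.
  have : c j - c i = 2 * (j - i)%:R * h by rewrite /c natrB 1?ltnW//; ring.
  by nra.
have xd (i j : nat) : ((i - j) + (j - i))%:R * h <= `|x i - x j|.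
  case: (ltngtP i j) => ij.
  - by rewrite (eqP (ltnW ij : i - j == 0)%N) add0n distrC (le_trans (dist _ _ ij))// ler_norm.
  - by rewrite (eqP (ltnW ij : j - i == 0)%N) addn0 (le_trans (dist _ _ ij))// ler_norm.
  - by rewrite ij subnn mul0r.
have xinj : injective (fun j => ((x j)%:C)%C : C).
  move=> i j /complexI xij; apply/eqP; apply: contraT => ij.
  have := xd i j; rewrite xij subrr normr0 pmulr_lle0//.
  by rewrite leNgt ltr0n; lia.
have xa (j : nat) : (j <= n)%N -> - a <= c j /\ c j + h <= a.
  move=> jn; have jn' : j%:R <= n%:R :> R by rewrite ler_nat.
  have ah : a = n%:R * h + h by rewrite /h -natr1; field; rewrite natr1 pnatr_eq0.
  have j0 : 0 <= j%:R :> R by [].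
  by rewrite /c {2 4}ah; split; nra.
(* The minimum over an interval of length [h], times [h], is at most the integral. *)
have PX (j : nat) : (j <= n)%N -> cabs P.[((x j)%:C)%C] <= X / h.
  move=> jn; have [ca ch] := xa j jn.
  rewrite ler_pdivlMr// -lee_fin; apply: le_trans IX.
  have mP : measurable_fun [set: R] (fun s : R => (cabs P.[(s%:C)%C])%:E).
    by apply/measurable_EFinP; exact: continuous_measurable_fun.
  apply: (@le_trans _ _ (\int[mu]_(s in `[c j, (c j + h)%R]) (cabs P.[(s%:C)%C])%:E)%E); last first.
    apply: ge0_subset_integral => //.
    - exact: measurable_funTS.
    - by move=> s _; rewrite lee_fin cabs_ge0.
    - by move=> s /=; rewrite !in_itv/= => /andP[s1 s2]; apply/andP; split; lra.
  apply: (@le_trans _ _ (\int[mu]_(s in `[c j, (c j + h)%R]) (cst (cabs P.[((x j)%:C)%C])%:E) s)%E).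
    rewrite integral_cst//= lebesgue_measure_itv/= lte_fin ltrDl h0 -EFinB -EFinM.
    by rewrite addrAC subrr add0r.
  apply: ge0_le_integral => //.
  - by move=> s _; rewrite /= lee_fin cabs_ge0.
  - exact: measurable_funTS.
  - by move=> s; rewrite /= in_itv/= => sI; rewrite lee_fin; exact: (xP j).2.
have X0 : 0 <= X / h by apply: le_trans (PX 0%N (leq0n n)); exact: cabs_ge0.
have PE := @lagrange_gen _ n.+1 (fun j => ((x j)%:C)%C : C) isT xinj P sP.
rewrite PE horner_sum; apply: (le_trans (cabs_sum _ _ _ _)).
(* With gaps at least [|i - j| h], a basis polynomial is at most [(2 |t| / h)^n / (i! (n - i)!)],
   and [1 / (i! (n - i)!)] is a binomial coefficient over [n!], hence at most [2^n / n!]. *)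
pose B := X / h * ((4 * (`|t| / h)) ^+ n / n`!%:R).
apply: (@le_trans _ _ (\sum_(i < n.+1) B)).
  apply: ler_sum => i _.
  have i_n : (i <= n)%N by rewrite -ltnS.
  rewrite hornerM hornerC cabsM lagrangeE//= hornerM hornerC cabsM cabsV !horner_prod !cabs_prod.
  apply: ler_pM; rewrite ?cabs_ge0//.
  - by rewrite mulr_ge0 ?invr_ge0 ?prodr_ge0// => *; exact: cabs_ge0.
  - exact: PX.
  have num : \prod_(j < n.+1 | j != i :> nat) cabs ('X - ((x j)%:C)%C%:P).[(t%:C)%C] <= (2 * `|t|) ^+ n.
    apply: (@le_trans _ _ (\prod_(j < n.+1 | j != i :> nat) (2 * `|t|))).
      apply: ler_prod => j _; rewrite cabs_ge0/= hornerXsubC -rmorphB cabs_real.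
      apply: (le_trans (ler_normB _ _)); rewrite mulrDl mul1r lerD2l.
      have jn : (j <= n)%N by rewrite -ltnS.
      have [ca ch] := xa j jn; have [/andP[x1 x2] _] := xP j.
      by rewrite ler_norml; apply/andP; split; lra.
    by rewrite prodr_const cardC1 card_ord.
  have den : h ^+ n * (i`! * (n - i)`!)%:R <=
      \prod_(j < n.+1 | j != i :> nat) cabs ('X - ((x j)%:C)%C%:P).[((x i)%:C)%C].
    apply: (@le_trans _ _ (\prod_(j < n.+1 | j != i :> nat) (((i - j) + (j - i))%:R * h))); last first.
      apply: ler_prod => j _; rewrite mulr_ge0 ?(ltW h0)//= hornerXsubC -rmorphB cabs_real.
      exact: xd.
    rewrite big_split/= prodr_const cardC1 card_ord mulrC -natr_prod -(prod_dist_ord _ _ i_n).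
    by rewrite big_mkord.
  have fact0 : 0 < (i`! * (n - i)`!)%:R :> R by rewrite ltr0n muln_gt0 !fact_gt0.
  have den0 : 0 < h ^+ n * (i`! * (n - i)`!)%:R by rewrite mulr_gt0// exprn_gt0.
  apply: (@le_trans _ _ ((h ^+ n * (i`! * (n - i)`!)%:R)^-1 * (2 * `|t|) ^+ n)).
    apply: ler_pM => //.
    - by rewrite invr_ge0 prodr_ge0// => *; exact: cabs_ge0.
    - by rewrite prodr_ge0// => *; exact: cabs_ge0.
    - by rewrite lef_pV2// posrE// (lt_le_trans den0).
  have -> : 4 * (`|t| / h) = 2 * ((2 * `|t|) / h) by ring.
  rewrite (exprMn _ 2 (_ / _)) (expr_div_n (2 * `|t|) h) invfM.
  have -> : (h ^+ n)^-1 / (i`! * (n - i)`!)%:R * (2 * `|t|) ^+ n =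
    ((h ^+ n)^-1 * (2 * `|t|) ^+ n) * (i`! * (n - i)`!)%:R^-1 by ring.
  have -> : 2 ^+ n * ((2 * `|t|) ^+ n / h ^+ n) / n`!%:R =
    ((h ^+ n)^-1 * (2 * `|t|) ^+ n) * (2 ^+ n / n`!%:R) by ring.
  have Z0 : 0 <= (h ^+ n)^-1 * (2 * `|t|) ^+ n.
    by rewrite mulr_ge0 ?invr_ge0 ?exprn_ge0 ?(ltW h0)// mulr_ge0.
  rewrite (ler_wpM2l Z0)//.
  rewrite -[leLHS]div1r ler_pdivrMr// mulrAC ler_pdivlMr ?ltr0n ?fact_gt0// mul1r.
  rewrite -natrX -natrM ler_nat -(bin_fact i_n) leq_mul2r bin_le_exp2 orbT//.
rewrite sumr_const card_ord -[leLHS]mulr_natl /B.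
(* The number of terms and [X / h = (X / a) (n + 1)] each cost a factor [n + 1 <= 2^n]; together
   with [4^n] and [(n + 1)^n / n! <= e^(n + 1)] this makes up the base [16 e]. *)
have n1 : n.+1%:R <= 2 ^+ n :> R by rewrite -natrX ler_nat ltn_expl.
have n10 : 0 < n.+1%:R :> R by [].
have fe : n.+1%:R ^+ n / n`!%:R <= expR n.+1%:R :> R.
  case: (n) => [|m]; first by rewrite expr0 fact0 divr1 -expR0 ler_expR.
  apply: le_trans (@expR_ge1Dxn R m.+2%:R m (ler0n _ _)).
  by rewrite lerDr.
have XhE : X / h = X / a * n.+1%:R by rewrite /h invf_div; ring.
rewrite XhE.
have -> : (4 * (`|t| / h)) ^+ n / n`!%:R = (4 * (`|t| / a)) ^+ n * (n.+1%:R ^+ n / n`!%:R).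
  rewrite [RHS]mulrA -exprMn; congr (_ ^+ _ / _).
  by rewrite /h invf_div; ring.
have X1 : 0 <= X / a.
  by move: X0; rewrite XhE pmulr_lge0.
have q0 : 0 <= (4 * (`|t| / a)) ^+ n.
  by rewrite exprn_ge0// mulr_ge0// divr_ge0// ltW.
apply: (@le_trans _ _ (2 ^+ n * (X / a * 2 ^+ n * ((4 * (`|t| / a)) ^+ n * expR n.+1%:R)))).
  have f0 : 0 <= n.+1%:R ^+ n / n`!%:R :> R by rewrite divr_ge0// exprn_ge0.
  have e1 : (4 * (`|t| / a)) ^+ n * (n.+1%:R ^+ n / n`!%:R) <=
            (4 * (`|t| / a)) ^+ n * expR n.+1%:R by rewrite ler_wpM2l.
  have e2 : X / a * n.+1%:R <= X / a * 2 ^+ n by rewrite ler_wpM2l.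
  apply: (ler_pM (ler0n _ _) _ n1); first by rewrite mulr_ge0// mulr_ge0.
  by apply: (ler_pM _ _ e2 e1); exact: mulr_ge0.
have -> : expR n.+1%:R = expR 1 ^+ n * expR 1 :> R.
  by rewrite -natr1 expRD -[X in expR X * _](mulr1 n%:R) expRM_natl.
rewrite (_ : 16 * expR 1 * (`|t| / a) = 2 * 2 * (4 * (`|t| / a)) * expR 1); last by ring.
rewrite (exprMn _ (2 * 2 * _)) (exprMn _ (2 * 2)) (exprMn _ 2) le_eqVlt; apply/orP; left.
by apply/eqP; ring.
Qed.

End Extrapolation.

(** * Lower bounds for the approximation error *)

Section LowerBound.
Context {R : realType}.
Notation mu := (@lebesgue_measure R).
Notation C := R[i].

Lemma prod_ge1 (I : eqType) (r : seq I) (f : I -> R) :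
  (forall i, i \in r -> 1 <= f i) -> 1 <= \prod_(i <- r) f i.
Proof.
elim: r => [|i r IH] f1; first by rewrite big_nil.
rewrite big_cons -[leLHS]mulr1; apply: ler_pM => //.
  by apply: f1; rewrite mem_head.
by apply: IH => j jr; apply: f1; rewrite in_cons jr orbT.
Qed.

Lemma sqrt_oneDsqr_ge1 (x : R) : 1 <= Num.sqrt (1 + x ^+ 2).
Proof. by rewrite -[leLHS]sqrtr1 ler_wsqrtr// lerDl sqr_ge0. Qed.

Lemma continuous_prod_sqrt (bs : seq R) :
  continuous (fun t : R => \prod_(b <- bs) Num.sqrt (1 + (t / b) ^+ 2)).
Proof.
elim: bs => [|b bs IH] t.
  rewrite (_ : (fun _ => _) = fun=> 1); first exact: cvg_cst.
  by apply/funext => s; rewrite big_nil.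
rewrite (_ : (fun _ => _) = fun s => Num.sqrt (1 + (s / b) ^+ 2) *
    \prod_(j <- bs) Num.sqrt (1 + (s / j) ^+ 2)); last first.
  by apply/funext => s; rewrite big_cons.
apply: cvgM; last exact: IH.
apply: (@cvg_comp _ _ _ (fun s : R => 1 + (s / b) ^+ 2) Num.sqrt); last exact: sqrt_continuous.
apply: cvgD; first exact: cvg_cst.
by apply: cvgM; apply: cvgM; solve [exact: cvg_id|exact: cvg_cst].
Qed.

(* [(20 e) * e ^ 4 * (16 e)], where one [e] and [16 e] come from
   [poly_extrapolation], [20] and [e ^ 4] from [extrapolation_const_le]. *)
Definition growth_const : R := 320 * expR 1 ^+ 6.

Lemma growth_const_ge0 : 0 <= growth_const.
Proof. by apply: mulr_ge0; [exact: ler0n|exact: exprn_ge0 (expR_ge0 _)]. Qed.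

(** Turns polynomial prefactors into an [n]-th power: [(1 + a^2)^2 <= 4 a^4], and division by [a]
    leaves [a^3 <= e^(3 n)]. The variable [c] stands for [pi + 1], and [20 = 4 * 5]. *)
Lemma extrapolation_const_le (a e k c : R) (n : nat) : 1 <= a -> 1 <= e -> a <= e ^+ n ->
  0 < k -> 0 <= c -> c <= 5 ->
  e ^+ n * (1 + a ^+ 2) ^+ 2 * (k * c) / a <= k * 20 * (e ^+ 4) ^+ n.
Proof.
move=> a1 e1 aen k0 c0 c5; have a0 : 0 < a by lra.
have en0 : 0 < e ^+ n by rewrite exprn_gt0//; lra.
rewrite -exprM mulnC exprM ler_pdivrMr//.
set x := e ^+ n in aen en0 *.
have h1 : (1 + a ^+ 2) ^+ 2 <= 4 * a ^+ 3 * a.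
  have h : 1 <= a ^+ 2 by rewrite exprn_ege1.
  rewrite (_ : 4 * a ^+ 3 * a = (2 * a ^+ 2) ^+ 2); last by ring.
  by rewrite ler_pXn2r ?nnegrE//; lra.
have h2 : 4 * a ^+ 3 * a <= 4 * x ^+ 3 * a.
  by rewrite ler_pM2r// ler_pM2l// ler_pXn2r ?nnegrE// ltW.
rewrite (_ : k * 20 * x ^+ 4 * a = x * (4 * x ^+ 3 * a) * (k * 5)); last by ring.
apply: ler_pM.
- by rewrite mulr_ge0 ?(ltW en0)// sqr_ge0.
- by rewrite mulr_ge0// ltW.
- by rewrite ler_pM2l//; lra.
- by rewrite ler_pM2l.
Qed.

(** If the norm were below the bound [k], the mean of [|P| / (W |t - i|)] would be small. Inside
    [[-a, a]] the product replaces [W] at the cost [C0]; outside, extrapolation bounds [|P|] by [k]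
    times the product. The mean value inequality then contradicts [P(i) = 1]. *)
Lemma En_ge_of_majorant (W : R -> R) (p : \bar R) (n : nat) (a C0 : R) (bs : seq R) :
  (forall t, 0 < W t) -> continuous W -> (1 <= p)%E -> (0 < n)%N ->
  1 <= a -> a <= expR 1 ^+ n -> (forall t, `|t| <= a -> W t <= expR 1 ^+ n) ->
  (forall b, b \in bs -> 0 < b) -> (n <= size bs)%N -> 0 < C0 ->
  (forall t, `|t| <= a -> W t <= C0 * \prod_(b <- bs) Num.sqrt (1 + (t / b) ^+ 2)) ->
  (forall t, a <= `|t| -> (growth_const * (`|t| / a)) ^+ n <=
                          \prod_(b <- bs) Num.sqrt (1 + (t / b) ^+ 2)) ->
  (((4 * (C0 + 1) * \prod_(b <- bs) (1 + b^-1))^-1)%:E <= En n p W)%E.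
Proof.
move=> W0 cW p1 n0 a1 aen Wen bs0 sbs C00 H1 H2.
have a0 : 0 < a by lra.
set B := \prod_(b <- bs) (1 + b^-1).
have B1 : 1 <= B by apply: prod_ge1 => b /bs0 b0; rewrite lerDl invr_ge0 ltW.
have B0 : 0 < B by lra.
set k := (_)^-1.
have k0 : 0 < k by rewrite invr_gt0 !mulr_gt0//; lra.
apply: En_ge => // P sP Pi1; rewrite leNgt; apply/negP => /ltW wk.
pose f (x : R) := P.[(x%:C)%C] / (x%:C - 'i)%C.
have cf : ccontinuous f by exact: ccontinuous_horner_div.
have := wnorm_mean_le W W0 cW p f k p1 k0 cf wk.
set g := fun t => cabs (f t) / W t => Ig.
have g0 t : 0 <= g t by rewrite divr_ge0 ?cabs_ge0// ltW.
pose s (t : R) := Num.sqrt (1 + t ^+ 2).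
have s1 t : 1 <= s t by exact: sqrt_oneDsqr_ge1.
have gE t : cabs P.[(t%:C)%C] = g t * W t * s t.
  rewrite /g divfK ?gt_eqF// /f cabsM cabsV cabs_subi divfK// gt_eqF//.
  by rewrite (lt_le_trans _ (s1 t)).
have o0 (t : R) : 0 < 1 + t ^+ 2 by exact: oneDsqr_gt0.
have cg : continuous g by exact: continuous_cabs_div.
have mg := measurable_div_oneDsqr _ cg.
(* On [[-a, a]] the weight is at most [e^n], while [|t - i|] and the density [1 / (1 + t^2)] cost at
   most [1 + a^2] each. *)
pose M := expR 1 ^+ n * (1 + a ^+ 2) ^+ 2.
have M0 : 0 < M by rewrite mulr_gt0// exprn_gt0// expR_gt0.
have nng t : (0 <= (g t / (1 + t ^+ 2))%:E)%E by rewrite lee_fin divr_ge0// ltW.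
have IP : (\int[mu]_(x in `[(- a)%R, a]) (cabs P.[(x%:C)%C])%:E <= (M * (k * (pi + 1)))%:E)%E.
  apply: (@le_trans _ _ (\int[mu]_(x in `[(- a)%R, a]) (M%:E * (g x / (1 + x ^+ 2))%:E))%E).
    apply: ge0_le_integral => //.
    - by move=> t _; rewrite lee_fin cabs_ge0.
    - apply/measurable_EFinP; apply: measurable_funTS; apply: continuous_measurable_fun.
      exact: continuous_cabs_horner.
    - by apply: measurable_funeM; exact: measurable_funTS.
    move=> t /=; rewrite in_itv/= -ler_norml => ta; rewrite -EFinM lee_fin gE.
    have t2 : t ^+ 2 <= a ^+ 2 by rewrite -real_normK ?num_real// ler_pXn2r// nnegrE ltW.
    have sq : s t <= 1 + t ^+ 2.
      rewrite -[leRHS]sqr_sqrtr ?(ltW (o0 t))// -/(s t) expr2 ler_peMl//.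
      by rewrite (le_trans _ (s1 t)).
    have ws : W t * s t <= expR 1 ^+ n * (1 + a ^+ 2).
      apply: ler_pM; rewrite ?(ltW (W0 t))//; first by rewrite (le_trans _ (s1 t)).
        exact: Wen.
      by rewrite (le_trans sq)// lerD2l.
    have -> : M * (g t / (1 + t ^+ 2)) = g t * (M / (1 + t ^+ 2)) by ring.
    rewrite -mulrA ler_wpM2l// ler_pdivlMr// /M expr2 mulrA.
    by apply: ler_pM => //; rewrite ?(ltW (o0 t))// ?lerD2l// mulr_ge0 ?(ltW (W0 t))// (le_trans _ (s1 t)).
  rewrite ge0_integralZl//; last 2 first.
  - exact: measurable_funTS.
  - by rewrite lee_fin ltW.
  rewrite [leRHS](EFinM M); apply: lee_wpmul2l; first by rewrite lee_fin ltW.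
  apply: le_trans Ig; exact: ge0_subset_integral.
have pi2 := @pi_ge2 R.
have pi4 : pi <= 4 :> R by have := @pihalf_lt2 R; lra.
have outer t : a <= `|t| -> cabs P.[(t%:C)%C] <= k * \prod_(b <- bs) Num.sqrt (1 + (t / b) ^+ 2).
  move=> ta; apply: le_trans (poly_extrapolation P n a _ t sP a0 ta IP) _.
  apply: (@le_trans _ _ (k * (growth_const * (`|t| / a)) ^+ n)); last first.
    by rewrite ler_pM2l// H2.
  set u := `|t| / a; have u0 : 0 <= u by rewrite divr_ge0// ltW.
  set e := expR 1 in aen Wen M M0 IP *.
  have e1 : 1 <= e by rewrite /e -expR0 ler_expR.
  have Xa : M * (k * (pi + 1)) / a <= k * 20 * (e ^+ 4) ^+ n.
    by apply: extrapolation_const_le => //; lra.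
  have c1 : 20 * e <= (20 * e) ^+ n.
    by rewrite -[leLHS]expr1; apply: ler_weXn2l => //; lra.
  have q0 : 0 <= (16 * e * u) ^+ n by apply: exprn_ge0; apply: mulr_ge0 => //; lra.
  apply: (@le_trans _ _ (k * 20 * (e ^+ 4) ^+ n * e * (16 * e * u) ^+ n)).
    by apply: ler_wpM2r => //; apply: ler_wpM2r => //; lra.
  have -> : growth_const * u = (20 * e) * (e ^+ 4) * (16 * e * u) by rewrite /growth_const -/e; ring.
  rewrite (exprMn _ (_ * _ ^+ 4)) (exprMn _ (20 * e)).
  have -> : k * 20 * (e ^+ 4) ^+ n * e * (16 * e * u) ^+ n =
    k * ((20 * e) * ((e ^+ 4) ^+ n * (16 * e * u) ^+ n)) by ring.
  rewrite ler_pM2l// -[leRHS]mulrA ler_wpM2r//.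
  by rewrite mulr_ge0// exprn_ge0// exprn_ge0//; lra.
(* The extra root at scale 1 supplies [z + i], whose modulus on the line cancels [|t - i|]; at [i]
   it costs the factor 2. *)
have := @ratio_mean_le R (1 :: bs) P.
rewrite Pi1 cabs1 big_cons invr1 -/B => /(_ _ _)/[!div1r] main.
have : ((pi * ((1 + 1) * B)^-1)%:E <= (C0 * (k * (pi + 1)) + k * pi)%:E)%E.
  apply: (le_trans (main _ _)).
  - by move=> b; rewrite in_cons => /predU1P[->//|/bs0].
  - by rewrite (leq_trans sP)// ltnS/= leqW.
  apply: (@le_trans _ _ (\int[mu]_t (C0%:E * (g t / (1 + t ^+ 2))%:E + k%:E * ((1 + t ^+ 2)^-1)%:E))%E).
    have mi : measurable_fun [set: R] (fun t : R => ((1 + t ^+ 2)^-1)%:E).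
      by apply/measurable_EFinP; apply: continuous_measurable_fun; exact: continuous_oneDsqrV.
    apply: ge0_le_integral => //.
    - move=> t _; rewrite lee_fin divr_ge0 ?(ltW (o0 t))// divr_ge0 ?cabs_ge0//.
      by rewrite prodr_ge0// => *; rewrite sqrtr_ge0.
    - apply: measurable_div_oneDsqr => x; apply: cvgM; first exact: continuous_cabs_horner.
      apply: cvgV; last exact: continuous_prod_sqrt.
      by apply: lt0r_neq0; apply: lt_le_trans (prod_ge1 _ _ _ _) => // b _; exact: sqrt_oneDsqr_ge1.
    - by apply: emeasurable_funD; exact: measurable_funeM.
    move=> t _; rewrite -!EFinM -EFinD lee_fin.
    rewrite (mulrA C0) -mulrDl ler_pM2r ?invr_gt0//.
    rewrite big_cons divr1 -/(s t); set rho := \prod_(b <- bs) _.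
    have rho1 : 1 <= rho by apply: prod_ge1 => *; exact: sqrt_oneDsqr_ge1.
    have st := s1 t.
    rewrite ler_pdivrMr ?mulr_gt0//; try lra.
    have [ta|ta] := leP `|t| a.
      rewrite gE; apply: (@le_trans _ _ (g t * (C0 * rho) * s t)).
        by rewrite ler_wpM2r ?ler_wpM2l ?H1//; lra.
      rewrite (_ : g t * (C0 * rho) * s t = C0 * g t * (s t * rho)); last by ring.
      rewrite ler_wpM2r ?lerDl ?(ltW k0)//.
      by rewrite mulr_ge0//; lra.
    apply: (le_trans (outer _ (ltW ta))); rewrite -/rho.
    apply: (@le_trans _ _ (k * (s t * rho))).
      by rewrite ler_pM2l// ler_peMl//; lra.
    rewrite ler_wpM2r ?lerDr//; first by rewrite mulr_ge0//; lra.
    by rewrite mulr_ge0// ltW.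
  have mi : measurable_fun [set: R] (fun t : R => ((1 + t ^+ 2)^-1)%:E).
    by apply/measurable_EFinP; apply: continuous_measurable_fun; exact: continuous_oneDsqrV.
  have nni (t : R) : (0 <= ((1 + t ^+ 2)^-1)%:E)%E by rewrite lee_fin invr_ge0 ltW.
  rewrite ge0_integralD//; last 4 first.
  - by move=> t _; apply: mule_ge0 => //; rewrite lee_fin ltW.
  - exact: measurable_funeM.
  - by move=> t _; apply: mule_ge0 => //; rewrite lee_fin ltW.
  - exact: measurable_funeM.
  rewrite !ge0_integralZl ?lee_fin ?(ltW C00) ?(ltW k0)//.
  rewrite integral_oneDsqr (EFinD (C0 * (k * (pi + 1))) (k * pi)) (EFinM k pi) (EFinM C0).
  by apply: leeD => //; apply: lee_wpmul2l => //; rewrite lee_fin ltW.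
(* With [k = D / (2 (C0 + 1))], the right side is below [D pi] because [pi + 1 < 2 pi]. *)
rewrite lee_fin leNgt => /negP; apply.
have kE : k = ((1 + 1) * B)^-1 / (2 * (C0 + 1)).
  by rewrite /k; field; rewrite (gt_eqF B0) gt_eqF//; lra.
have D0 : 0 < ((1 + 1) * B)^-1 by rewrite invr_gt0; lra.
rewrite kE; move: ((1 + 1) * B)^-1 D0 => D D0.
move: (pi) pi2 => c c2.
have -> : C0 * (D / (2 * (C0 + 1)) * (c + 1)) + D / (2 * (C0 + 1)) * c
   = D * ((C0 * (c + 1) + c) / (2 * (C0 + 1))) by ring.
rewrite mulrC ltr_pM2r// ltr_pdivrMr; nra.
Qed.

End LowerBound.

(** * Majorants of the weight built on dyadic scales *)

Section DyadicMajorant.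
Context {R : realType}.

Lemma continuous_comp_normr (phi : R -> R) :
  {within `[0, +oo[, continuous phi} -> continuous (fun t : R => phi `|t|).
Proof.
move=> /continuous_within_itvcyP[c1 c0] t.
have [->|t0] := eqVneq t 0; last first.
  apply: (@continuous_comp R R R (fun x => `|x|) phi t).
    by apply: cvg_norm; exact: cvg_id.
  by apply: c1; rewrite in_itv/= andbT normr_gt0.
apply/cvgrPdist_le => e e0; move/cvgrPdist_le: c0 => /(_ _ e0).
rewrite /at_right near_withinE => -[d /= d0 h].
exists d => // s /=; rewrite sub0r normrN => sd; rewrite normr0.
have [->|s0] := eqVneq s 0; first by rewrite normr0 subrr normr0 ltW.
by apply: h; rewrite ?normr_gt0//= sub0r normrN normr_id.
Qed.

(** Up to a factor 2, the right-endpoint Riemann sum of [phi t / t^2] over the dyadic partition of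
    [[b, b 2^J]]. *)
Definition dyadic_sum (phi : R -> R) (b : R) (J : nat) : R :=
  \sum_(k < J) phi (b * 2 ^+ k.+1) / (b * 2 ^+ k.+1).

Definition dyadic_roots (m : nat -> nat) (M : nat) (b : R) (J : nat) : seq R :=
  flatten [seq nseq (m k) (b * 2 ^+ k) | k <- iota 0 J] ++ nseq M (b * 2 ^+ J).

Lemma prod_dyadic_roots m M b J (F : R -> R) :
  \prod_(x <- dyadic_roots m M b J) F x =
  (\prod_(k < J) F (b * 2 ^+ k) ^+ m k) * F (b * 2 ^+ J) ^+ M.
Proof.
have pn k x : \prod_(i <- nseq k x) F i = F x ^+ k.
  by rewrite big_nseq; elim: k => //= k ->; rewrite exprS.
rewrite /dyadic_roots big_cat/= pn; congr (_ * _).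
rewrite big_flatten/= big_map -{1}(subn0 J) -/(index_iota 0 J) big_mkord.
by apply: eq_bigr => k _; rewrite pn.
Qed.

Lemma dyadic_roots_gt0 m M b J x : 0 < b -> x \in dyadic_roots m M b J -> 0 < x.
Proof.
move=> b0; rewrite mem_cat => /orP[/flattenP[s /mapP[k _ ->]]|].
  by rewrite mem_nseq => /andP[_ /eqP->]; rewrite mulr_gt0// exprn_gt0.
by rewrite mem_nseq => /andP[_ /eqP->]; rewrite mulr_gt0// exprn_gt0.
Qed.

Lemma dyadic_bracket (b t : R) (J : nat) : 0 < b -> b <= t -> t <= b * 2 ^+ J ->
  t = b \/ exists2 k, (k < J)%N & b * 2 ^+ k <= t <= b * 2 ^+ k.+1.
Proof.
move=> b0 bt; elim: J => [|J IH] tJ.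
  by left; apply/eqP; rewrite eq_le bt andbT -[b]mulr1 -(expr0 2).
have [tJ'|tJ'] := leP t (b * 2 ^+ J).
  have [->|[k kJ kt]] := IH tJ'; [by left|right; exists k => //; exact: leqW].
by right; exists J => //; rewrite tJ (ltW tJ').
Qed.

Lemma expR_quarter_le_sqrt2 : expR (4^-1) <= Num.sqrt (2 : R).
Proof.
have h : expR (2^-1 : R) <= 2.
  have := @expR_ge1Dx R (- 2^-1); rewrite expRN => h.
  by rewrite -[leLHS]invrK invf_ple ?posrE ?invr_gt0 ?expR_gt0//; lra.
rewrite -(@ger0_norm _ (expR _)) ?expR_ge0// -sqrtr_sqr ler_wsqrtr//.
apply: le_trans h; rewrite expr2 -expRD ler_expR; lra.
Qed.

(** One scale already dominates the weight on [[s, 2 s]]: each factor there is at least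
    [sqrt 2 >= e^(1/4)], and [4 phi(2 s)] of them reach [e^(phi(2 s))]. Below [b] the constant
    [e^(phi b)] is paid instead. *)
Lemma En_ge_dyadic (phi : R -> R) :
  continuous (fun t : R => phi `|t|) ->
  (forall x y, 0 <= x -> x <= y -> phi x <= phi y) -> 0 < phi 0 ->
  exists2 C : R, 0 < C & forall (p : \bar R) (b : R) (J n : nat),
    (1 <= p)%E -> 0 < b -> (0 < n)%N -> (0 < J)%N -> phi (b * 2 ^+ J) = n%:R ->
    1 <= b * 2 ^+ J -> b * 2 ^+ J <= expR 1 ^+ n ->
    (((4 * (expR (phi b) + 1))^-1 * expR (- C * dyadic_sum phi b J))%:E
      <= En n p (fun t => expR (phi `|t|%R)))%E.
Proof.
move=> cphi mono phi0.
have phi_gt0 x : 0 <= x -> 0 < phi x by move=> x0; apply: lt_le_trans (mono _ _ _ x0).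
pose N := Num.bound (@growth_const R).
have KN : @growth_const R <= 2 ^+ N.
  have K0 := @growth_const_ge0 R.
  apply: (le_trans (ltW (archi_boundP K0))).
  by rewrite -natrX ler_nat ltnW// ltn_expl.
(* At [u = |t| / a >= 1], [2 N] of the [M] factors give [(1 + u^2)^N >= 2^N >= growth_const], and
   the last one gives [u]. *)
pose M := (N + N).+1.
(* The term [1 / phi 0] absorbs the rounding up of the multiplicities, and the 2 turns [1 / s] into
   a multiple of [1 / (2 s)]. *)
pose C1 := 2 * (4 + (phi 0)^-1).
have C10 : 0 < C1 by rewrite mulr_gt0// addr_gt0// invr_gt0.
exists (C1 + M%:R); first by rewrite addr_gt0.
move=> p b J n p1 b0 n0 J0 phia a1 aen.
have sk0 k : 0 < b * 2 ^+ k by rewrite mulr_gt0// exprn_gt0.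
pose m k := (Num.truncn (4 * phi (b * 2 ^+ k.+1))).+1.
have m_ge k : 4 * phi (b * 2 ^+ k.+1) <= (m k)%:R.
  by rewrite ltW// truncnS_gt.
have m_le k : (m k)%:R <= (4 + (phi 0)^-1) * phi (b * 2 ^+ k.+1).
  have p0 := phi_gt0 _ (ltW (sk0 k.+1)).
  rewrite (mulrDl 4 (phi 0)^-1) /m -[leLHS]natr1; apply: lerD.
    by rewrite truncn_le mulr_ge0// ltW.
  rewrite mulrC ler_pdivlMr// mul1r; exact: mono (ltW (sk0 k.+1)).
set a := b * 2 ^+ J in phia a1 aen *.
pose bs := dyadic_roots m (M * n) b J.
have a0 : 0 < a by lra.
have C00 := expR_gt0 (phi b).
have C01 : 1 <= expR (phi b) by rewrite -expR0 ler_expR ltW// phi_gt0// ltW.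
pose F (x : R) := Num.sqrt (1 + x ^+ 2).
have F1 x : 1 <= F x by exact: sqrt_oneDsqr_ge1.
have F0 x : 0 <= F x by exact: sqrtr_ge0.
have rho_ge t k : (k < J)%N ->
    F (t / (b * 2 ^+ k)) ^+ m k <= \prod_(x <- bs) F (t / x).
  move=> kJ; rewrite /bs (prod_dyadic_roots m (M * n) b J (fun x => F (t / x))).
  rewrite (bigD1 (Ordinal kJ))//= -mulrA ler_peMr ?exprn_ge0 ?F0//.
  rewrite -[leLHS]mulr1; apply: ler_pM => //; last by rewrite exprn_ege1.
  rewrite -big_filter; apply: prod_ge1 => i _; exact: exprn_ege1.
have rho1 t : 1 <= \prod_(x <- bs) F (t / x) by apply: prod_ge1.
have main := En_ge_of_majorant (fun t => expR (phi `|t|)) p n a (expR (phi b)) bs.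
apply: le_trans (main _ _ _ _ _ _ _ _ _ _ _ _) => //.
- rewrite lee_fin [leRHS]invfM ler_pM2l ?invr_gt0 ?mulr_gt0 ?addr_gt0//.
  rewrite mulNr expRN lef_pV2 ?posrE ?expR_gt0//; last first.
    apply: lt_le_trans (prod_ge1 _ _ _ _) => // x xbs.
    by rewrite lerDl invr_ge0 ltW// (dyadic_roots_gt0 _ _ _ _ _ b0 xbs).
  rewrite (prod_dyadic_roots m (M * n) b J (fun x => 1 + x^-1)) mulrDl expRD.
  apply: ler_pM.
  - by apply: prodr_ge0 => k _; rewrite exprn_ge0// addr_ge0// invr_ge0 ltW.
  - by rewrite exprn_ge0// addr_ge0// invr_ge0 ltW.
  - rewrite /dyadic_sum mulr_sumr expR_sum; apply: ler_prod => k _.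
    rewrite exprn_ge0 ?addr_ge0 ?invr_ge0 ?(ltW (sk0 k))//=.
    apply: (@le_trans _ _ (expR ((b * 2 ^+ k)^-1) ^+ m k)).
      by rewrite ler_pXn2r ?nnegrE ?expR_ge0 ?addr_ge0 ?invr_ge0 ?(ltW (sk0 k))// expR_ge1Dx.
    rewrite -expRM_natl ler_expR.
    apply: (@le_trans _ _ ((4 + (phi 0)^-1) * phi (b * 2 ^+ k.+1) / (b * 2 ^+ k))).
      by rewrite ler_pM2r ?invr_gt0.
    rewrite le_eqVlt; apply/orP; left; apply/eqP.
    by rewrite /C1 exprS; field; rewrite (gt_eqF b0) (gt_eqF phi0) expf_neq0.
  (* The roots at [a] contribute [M n / a], which is [M] times the last term of the dyadic sum,
     because [phi a = n]. *)
  apply: (@le_trans _ _ (expR (a^-1) ^+ (M * n))).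
    by rewrite ler_pXn2r ?nnegrE ?expR_ge0 ?addr_ge0 ?invr_ge0 ?(ltW a0)// ?expR_ge1Dx// muln_gt0.
  rewrite -expRM_natl ler_expR natrM -mulrA ler_pM2l//.
  case: J J0 @a phia a1 aen @bs a0 rho_ge rho1 main => // J _ a phia _ _ _ _ _ _ _.
  rewrite /dyadic_sum big_ord_recr/= -/a phia lerDr sumr_ge0// => k _.
  by rewrite divr_ge0 ?ltW// phi_gt0// ltW.
- by move=> t; exact: expR_gt0.
- by move=> t; apply: (@cvg_comp _ _ _ (fun t : R => phi `|t|) expR); [exact: cphi|exact: continuous_expR].
- move=> t ta; rewrite -expRM_natl mulr1 ler_expR -phia; exact: mono.
- by move=> x; exact: dyadic_roots_gt0.
- by rewrite size_cat size_nseq (leq_trans _ (leq_addl _ _))// leq_pmull.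
- move=> t ta.
  have [tb|bt] := leP `|t| b.
    apply: (@le_trans _ _ (expR (phi b))); first by rewrite ler_expR mono.
    by rewrite ler_peMr ?(ltW C00)//; exact: rho1.
  have [tb|[k kJ /andP[kt tk]]] := dyadic_bracket b `|t| J b0 (ltW bt) ta.
    by move: bt; rewrite tb ltxx.
  apply: (@le_trans _ _ (F (t / (b * 2 ^+ k)) ^+ m k)); last first.
    apply: (le_trans (rho_ge t k kJ)); rewrite ler_peMl//.
    by rewrite (le_trans _ (rho1 t)).
  apply: (@le_trans _ _ (expR 4^-1 ^+ m k)).
    rewrite -expRM_natl ler_expR.
    have := mono _ _ (normr_ge0 t) tk; have := m_ge k; lra.
  rewrite ler_pXn2r ?nnegrE ?expR_ge0 ?F0//.
  apply: (le_trans expR_quarter_le_sqrt2); rewrite /F ler_wsqrtr// -[leLHS]/(1 + 1) lerD2l.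
  rewrite -real_normK ?num_real// normrM normfV (ger0_norm (ltW (sk0 k))).
  by rewrite exprn_ege1// ler_pdivlMr// mul1r.
move=> t ta; set u := `|t| / a.
have u1 : 1 <= u by rewrite ler_pdivlMr// mul1r.
rewrite -/(F _) (prod_dyadic_roots m (M * n) b J (fun x => F (t / x))) -/a.
have FE : F (t / a) = F u by rewrite /F -[in LHS]real_normK ?num_real// normrM normfV (gtr0_norm a0).
apply: (@le_trans _ _ (F (t / a) ^+ (M * n))); last first.
  rewrite ler_peMl ?exprn_ge0 ?F0//.
  by apply: prod_ge1 => k _; exact: exprn_ege1.
rewrite FE exprM.
have u0 : 0 <= u by lra.
have K0 := @growth_const_ge0 R.
have Ku0 : 0 <= @growth_const R * u by exact: mulr_ge0.
rewrite ler_pXn2r ?nnegrE ?exprn_ge0 ?F0//.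
have F2 : F u ^+ 2 = 1 + u ^+ 2 by rewrite sqr_sqrtr// ltW// oneDsqr_gt0.
rewrite /M exprS mulrC addnn -mul2n exprM; apply: ler_pM.
- exact: u0.
- exact: K0.
- rewrite -[leLHS]ger0_norm//.
  by rewrite -sqrtr_sqr ler_wsqrtr// lerDr.
- apply: (le_trans KN); rewrite F2 ler_pXn2r ?nnegrE//; nra.
Qed.

End DyadicMajorant.

(** * Upper bounds for the approximation error *)

Section Chebyshev.
Context {R : realType}.
Notation C := R[i].

(** Two consecutive polynomials are carried along to make the three-term recurrence structural. *)
Fixpoint chebyshev_pair (n : nat) : {poly C} * {poly C} :=
  if n is n'.+1 then
    let: (p, q) := chebyshev_pair n' in (q, 2%:P * 'X * q - p)
  else (1, 'X).

Definition chebyshev n := (chebyshev_pair n).1.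

Lemma chebyshevSS n :
  chebyshev n.+2 = 2%:P * 'X * chebyshev n.+1 - chebyshev n.
Proof. by rewrite /chebyshev /=; case: (chebyshev_pair n). Qed.

Lemma chebyshev_ind2 (Q : nat -> Prop) :
  Q 0%N -> Q 1%N -> (forall n, Q n -> Q n.+1 -> Q n.+2) -> forall n, Q n.
Proof.
move=> q0 q1 qS n; suff [] : Q n /\ Q n.+1 by [].
by elim: n => // n [qn qn1]; split => //; exact: qS.
Qed.

Lemma size_chebyshev n : (size (chebyshev n) <= n.+1)%N.
Proof.
elim/chebyshev_ind2: n => [||n IH1 IH2]; rewrite ?size_poly1 ?size_polyX//.
have h : (size ('X * chebyshev n.+1)%R <= n.+3)%N.
  by rewrite (leq_trans (size_polyMleq _ _))// size_polyX/=.
rewrite chebyshevSS (leq_trans (size_polyD _ _))// geq_max size_polyN; apply/andP; split.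
  by rewrite -mulrA mul_polyC (leq_trans (size_scale_leq _ _)).
by rewrite (leq_trans IH1)// leqW.
Qed.

(** The Joukowski parametrization serves on the interval ([u], [v] conjugate of modulus 1), outside
    it ([u], [v] real) and on the imaginary axis alike. *)
Lemma horner_chebyshev (u v z : C) n : u * v = 1 -> u + v = 2 * z ->
  2 * (chebyshev n).[z] = u ^+ n + v ^+ n.
Proof.
move=> uv uvz; elim/chebyshev_ind2: n => [||n IH1 IH2].
- by rewrite hornerC mulr1 !expr0.
- by rewrite hornerX !expr1.
rewrite chebyshevSS hornerD hornerN !hornerM hornerC hornerX mulrBr IH1.
rewrite (_ : 2 * (2 * z * _) = (2 * z) * (2 * (chebyshev n.+1).[z])); last by ring.
rewrite IH2 -uvz.
have -> : (u + v) * (u ^+ n.+1 + v ^+ n.+1) =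
  u ^+ n.+2 + v ^+ n.+2 + (u * v) * (u ^+ n + v ^+ n) by rewrite !exprS; ring.
by rewrite uv mul1r addrK.
Qed.

Lemma cabs_2 : cabs (2 : C) = 2.
Proof. by rewrite -[2]/(1 + 1) -(rmorph1 (real_complex R)) -rmorphD cabs_real ger0_norm. Qed.

Lemma cabs_chebyshev_le1 (x : R) n : `|x| <= 1 -> cabs (chebyshev n).[(x%:C)%C] <= 1.
Proof.
move=> x1; pose s := Num.sqrt (1 - x ^+ 2).
have s2 : s ^+ 2 = 1 - x ^+ 2.
  by rewrite sqr_sqrtr// subr_ge0 -real_normK ?num_real// exprn_ile1.
have uv : Complex x s * Complex x (- s) = 1 :> C.
  by apply/eqP; rewrite eq_complex/=; apply/andP; split; apply/eqP; [nra|ring].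
have uz : Complex x s + Complex x (- s) = 2 * (x%:C)%C :> C.
  apply/eqP; rewrite eq_complex/=; apply/andP; split; apply/eqP; ring.
have uabs e : e ^+ 2 = s ^+ 2 -> cabs (Complex x e) = 1.
  by move=> es; rewrite /cabs/= /ComplexField.Normc.normc/= es s2 addrC subrK sqrtr1.
have := horner_chebyshev _ _ _ n uv uz => /(congr1 (@cabs R)).
rewrite cabsM cabs_2 => h.
have := cabsD (Complex x s ^+ n) (Complex x (- s) ^+ n).
by rewrite -h !cabsX !uabs ?sqrrN// expr1n; lra.
Qed.

Lemma cabs_chebyshev_le (x : R) n : 1 <= `|x| ->
  cabs (chebyshev n).[(x%:C)%C] <= (2 * `|x|) ^+ n.
Proof.
move=> x1; pose s := Num.sqrt (x ^+ 2 - 1).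
have s0 : 0 <= s by exact: sqrtr_ge0.
have s2 : s ^+ 2 = x ^+ 2 - 1.
  by rewrite sqr_sqrtr// subr_ge0 -real_normK ?num_real// exprn_ege1.
have nx2 : `|x| ^+ 2 = x ^+ 2 by rewrite real_normK ?num_real.
have sx : s <= `|x| by rewrite -(@ler_pXn2r _ 2)// ?nnegrE// nx2; lra.
have uv : ((x + s)%:C)%C * ((x - s)%:C)%C = 1 :> C.
  rewrite -rmorphM/= (_ : _ * _ = x ^+ 2 - s ^+ 2); last by ring.
  by rewrite s2 (_ : _ - _ = 1) ?rmorph1//; ring.
have uz : ((x + s)%:C)%C + ((x - s)%:C)%C = 2 * (x%:C)%C :> C.
  by rewrite -rmorphD/= (_ : x + s + (x - s) = x + x) ?rmorphD/=; ring.
have := horner_chebyshev _ _ _ n uv uz => /(congr1 (@cabs R)).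
rewrite cabsM cabs_2 => h.
have := cabsD (((x + s)%:C)%C ^+ n) (((x - s)%:C)%C ^+ n).
rewrite -h !cabsX !cabs_real.
have b1 : `|x + s| ^+ n <= (2 * `|x|) ^+ n.
  by apply: lerXn2r; rewrite ?nnegrE ?mulr_ge0//; have := ler_normD x s; rewrite (ger0_norm s0); lra.
have b2 : `|x - s| ^+ n <= (2 * `|x|) ^+ n.
  by apply: lerXn2r; rewrite ?nnegrE ?mulr_ge0//; have := ler_normB x s; rewrite (ger0_norm s0); lra.
lra.
Qed.

(** Here [|u| = y + sqrt (1 + y^2) >= 1 + y] and [|v| <= 1]. For [y = 1 / a] this makes the value at
    [i] of the rescaled polynomial exponentially large in [n / a]. *)
Lemma cabs_chebyshev_imaginary_ge (y : R) n : 0 < y ->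
  (1 + y) ^+ n - 1 <= 2 * cabs (chebyshev n).[Complex 0 y].
Proof.
move=> y0; pose s := Num.sqrt (1 + y ^+ 2).
have s1 : 1 <= s by rewrite -[leLHS]sqrtr1 ler_wsqrtr// lerDl sqr_ge0.
have s2 : s ^+ 2 = 1 + y ^+ 2 by rewrite sqr_sqrtr// addr_ge0// sqr_ge0.
have uv : Complex 0 (y + s) * Complex 0 (y - s) = 1 :> C.
  by apply/eqP; rewrite eq_complex/=; apply/andP; split; apply/eqP; [nra|ring].
have uz : Complex 0 (y + s) + Complex 0 (y - s) = 2 * Complex 0 y :> C.
  apply/eqP; rewrite eq_complex/=; apply/andP; split; apply/eqP; ring.
have := horner_chebyshev _ _ _ n uv uz => /(congr1 (@cabs R)).
rewrite cabsM cabs_2 => ->.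
have cI e : cabs (Complex 0 e) = `|e| :> R.
  by rewrite /cabs/= /ComplexField.Normc.normc/= expr0n/= add0r sqrtr_sqr.
have := cabsB_le (Complex 0 (y + s) ^+ n) (- Complex 0 (y - s) ^+ n).
rewrite opprK cabsN !cabsX !cI => /(le_trans _); apply.
apply: lerB; first by apply: lerXn2r; rewrite ?nnegrE ?normr_ge0//; [lra|rewrite ger0_norm; lra].
rewrite exprn_ile1// ler_norml; apply/andP; split; last by nra.
by nra.
Qed.

End Chebyshev.

(** * Polynomials below the square root of the weight *)

Section UpperBound.
Context {R : realType}.
Notation C := R[i].
Variable phi : R -> R.
Hypotheses (cphi : continuous (fun t : R => phi `|t|))
  (mono : forall x y : R, 0 <= x -> x <= y -> phi x <= phi y)
  (phi_gt0 : forall x : R, 0 <= x -> 0 < phi x).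

Lemma expR_half_le (y : R) : 0 <= y -> y <= 1 -> expR (y / 2) <= 1 + y.
Proof.
move=> y0 y1; have := @expR_ge1Dx R (- (y / 2)); rewrite expRN => h.
rewrite -[leLHS]invrK invf_ple ?posrE ?invr_gt0 ?expR_gt0//; last lra.
apply: le_trans h; rewrite -[leLHS]div1r ler_pdivrMr; last lra.
by nra.
Qed.

(** The fourth power is what makes the square root of [1 / W] decay like [1 / t^2]. *)
Lemma weight_decay_bound :
  (t ^+ 4 / expR (phi `|t|)) @[t --> +oo] --> (0 : R) ->
  exists2 B : R, 0 < B & forall t : R, expR (- (phi `|t| / 2)) <= B / (1 + t ^+ 2).
Proof.
move=> /cvgrPdist_le/(_ 1 ltr01) near1.
have [T [T1 hT]] : exists T : R, 1 <= T /\ forall t, T <= t -> t ^+ 4 <= expR (phi t).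
  move: near1 => [T0 [_ h]].
  exists (Num.max 1 (T0 + 1)); split; first by rewrite le_max lexx.
  move=> t; rewrite ge_max => /andP[t1 tT].
  have := h t; rewrite /= sub0r normrN (ger0_norm (_ : 0 <= t)); last lra.
  rewrite ger0_norm ?divr_ge0 ?exprn_ge0 ?expR_ge0//; last lra.
  by rewrite ler_pdivrMr ?expR_gt0// mul1r; apply; lra.
(* For [|t| <= T] the bound [1 + T^2] suffices; beyond, [e^(phi / 2) >= t^2 >= 1] gives 2. *)
exists (2 + (1 + T ^+ 2)); first by rewrite !addr_gt0// exprn_gt0//; lra.
move=> t; rewrite ler_pdivlMr ?oneDsqr_gt0//.
have [tT|Tt] := leP `|t| T.
  apply: (@le_trans _ _ (1 * (1 + T ^+ 2))); last first.
    by rewrite mul1r lerDr.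
  apply: ler_pM; rewrite ?expR_ge0 ?(ltW (oneDsqr_gt0 _))//.
    by rewrite -expR0 ler_expR oppr_le0 divr_ge0// ltW// phi_gt0.
  by rewrite lerD2l -real_normK ?num_real// ler_pXn2r ?nnegrE//; lra.
apply: (@le_trans _ _ 2); last by rewrite lerDl addr_ge0// sqr_ge0.
rewrite expRN mulrC ler_pdivrMr ?expR_gt0//.
have e2 : expR (phi `|t| / 2) ^+ 2 = expR (phi `|t|) by rewrite expr2 -expRD; congr expR; lra.
have h4 := hT _ (ltW Tt).
have h2 : `|t| ^+ 2 <= expR (phi `|t| / 2).
  by rewrite -(@ler_pXn2r _ 2)// ?nnegrE ?exprn_ge0 ?expR_ge0// e2 -exprM.
have : 1 <= `|t| ^+ 2 by rewrite exprn_ege1//; lra.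
rewrite (real_normK (num_real t)) in h2 *; lra.
Qed.

Lemma En_le_of_half_weight (B M : R) (P : {poly C}) (n : nat) (p : \bar R) :
  (1 <= p)%E -> 0 < B -> 0 < M ->
  (forall t : R, expR (- (phi `|t| / 2)) <= B / (1 + t ^+ 2)) ->
  (size P <= n.+1)%N -> P.['i%C] != 0 ->
  (forall t : R, cabs P.[(t%:C)%C] <= M * expR (phi `|t| / 2)) ->
  (En n p (fun t => expR (phi `|t|%R)) <= (4 * (M * B / cabs P.['i%C]))%:E)%E.
Proof.
move=> p1 B0 M0 hB sP Pi0 hP; apply: En_le => //.
- by move=> t; exact: expR_gt0.
- by move=> t; apply: (@cvg_comp _ _ _ (fun t : R => phi `|t|) expR); [exact: cphi|exact: continuous_expR].
- exact: mulr_gt0.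
move=> t; apply: (@le_trans _ _ (M * expR (phi `|t| / 2) / expR (phi `|t|))).
  by rewrite ler_pM2r ?invr_gt0 ?expR_gt0.
rewrite -!mulrA ler_pM2l// -expRN -expRD (_ : _ - _ = - (phi `|t| / 2)) ?hB//.
by lra.
Qed.

(** With [u = |t| / a >= 1], the bound [(2 u)^m <= e^(2 u m) <= e^(n u / 2) <= e^(phi / 2)] uses
    [4 m <= n] and the at least linear growth of [phi] beyond [a]. At [i] the modulus is at least
    [(E - 1) / 2 >= E / 4] for [E = e^(m / (2 a))], hence the 16. *)
Lemma En_le_chebyshev (B a : R) (m n : nat) (p : \bar R) :
  (1 <= p)%E -> 0 < B -> (forall t : R, expR (- (phi `|t| / 2)) <= B / (1 + t ^+ 2)) ->
  1 <= a -> (4 * m <= n)%N -> (forall t, a <= t -> n%:R * (t / a) <= phi t) ->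
  2 <= expR (m%:R / (2 * a)) ->
  (En n p (fun t => expR (phi `|t|%R)) <= (16 * B * expR (- (m%:R / (2 * a))))%:E)%E.
Proof.
move=> p1 B0 hB a1 mn hphi e2.
have a0 : 0 < a by lra.
pose P : {poly C} := chebyshev m \Po ((a^-1%:C)%C *: 'X).
have PE (z : C) : P.[z] = (chebyshev m).[(a^-1%:C)%C * z] by rewrite horner_comp hornerZ hornerX.
have sP : (size P <= n.+1)%N.
  rewrite /P size_comp_poly2; first by rewrite (leq_trans (size_chebyshev m))//; lia.
  rewrite size_scale ?size_polyX// eq_complex/= invr_eq0 eqxx andbT gt_eqF//.
have Pi : expR (m%:R / (2 * a)) - 1 <= 2 * cabs P.['i%C].
  rewrite PE (_ : _ * _ = Complex 0 a^-1); last first.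
    by apply/eqP; rewrite eq_complex/=; apply/andP; split; apply/eqP; ring.
  apply: le_trans (cabs_chebyshev_imaginary_ge _ m _); last by rewrite invr_gt0.
  rewrite lerD2r (_ : m%:R / (2 * a) = m%:R * (a^-1 / 2)); last by rewrite invfM; ring.
  rewrite expRM_natl lerXn2r ?nnegrE ?expR_ge0 ?addr_ge0 ?invr_ge0 ?(ltW a0)//.
  by apply: expR_half_le; rewrite ?invr_ge0 ?invf_le1 ?(ltW a0).
have Pi0 : P.['i%C] != 0 by rewrite -cabs_eq0 gt_eqF//; lra.
have hP (t : R) : cabs P.[(t%:C)%C] <= 1 * expR (phi `|t| / 2).
  rewrite mul1r PE -rmorphM/=.
  have -> : a^-1 * t = t / a by rewrite mulrC.
  have nt : `|t / a| = `|t| / a by rewrite normrM normfV (gtr0_norm a0).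
  have [ta|ta] := leP `|t| a.
    apply: (@le_trans _ _ 1); first by rewrite cabs_chebyshev_le1// nt ler_pdivrMr ?mul1r.
    by rewrite -expR0 ler_expR divr_ge0// ltW// phi_gt0.
  have u1 : 1 <= `|t| / a by rewrite ler_pdivlMr// mul1r ltW.
  apply: (le_trans (cabs_chebyshev_le _ m _)); rewrite nt//.
  apply: (@le_trans _ _ (expR (2 * (`|t| / a)) ^+ m)).
    apply: lerXn2r; rewrite ?nnegrE ?expR_ge0//; first by rewrite mulr_ge0//; lra.
    by apply: le_trans (expR_ge1Dx _); rewrite lerDr.
  rewrite -expRM_natl ler_expR.
  have := hphi _ (ltW ta).
  have : 4 * m%:R <= n%:R :> R by rewrite -natrM ler_nat.
  by nra.
apply: (le_trans (En_le_of_half_weight _ _ _ _ _ p1 B0 ltr01 hB sP Pi0 hP)).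
rewrite lee_fin mul1r expRN.
set E := expR _ in Pi e2 *; set c := cabs _ in Pi *.
have E0 : 0 < E by lra.
have c0 : 0 < c by lra.
rewrite mulrA ler_pdivrMr//.
have -> : 16 * B / E * c = (4 * B) * (4 * c / E) by ring.
rewrite ler_peMr ?mulr_ge0 ?(ltW B0)// ler_pdivlMr//; lra.
Qed.

End UpperBound.

(** * Summation by parts and second differences *)

Section SummationByParts.
Context {R : realType}.
Implicit Types (f L : nat -> R).

(** An inequality rather than an identity because the initial boundary term, nonnegative by
    hypothesis, is dropped. *)
Lemma abel_le f L N : 0 <= (f 1%N - f 0%N) * L 1%N ->
  \sum_(k < N) ((f k.+2 - f k.+1) - (f k.+1 - f k)) * L k.+1 <=
  (f N.+1 - f N) * L N.+1 + \sum_(k < N) (f k.+2 - f k.+1) * (L k.+1 - L k.+2).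
Proof.
move=> h0; elim: N => [|N IH]; first by rewrite !big_ord0 addr0.
by rewrite !big_ord_recr/=; lra.
Qed.

(** Away from the ends, the coefficient of [f j] is [2^(- j) (2 - 2 + 1/2)]: geometric weights
    reproduce themselves with the factor one half, and the rest is boundary terms. *)
Lemma sum_second_difference f N :
  \sum_(k < N) ((f k.+2 - f k.+1) - (f k.+1 - f k)) / 2 ^+ k.+1 =
  (\sum_(k < N) f k.+1 / 2 ^+ k.+1) / 2 + (2 * f N.+1 - f N) / 2 ^+ N.+1
    + f 0%N / 2 - f 1%N.
Proof.
elim: N => [|N IH]; first by rewrite !big_ord0 expr1; field.
rewrite !big_ord_recr/= IH !exprS; field; exact: expf_neq0.
Qed.

Lemma sum_half_exp_le1 N : \sum_(k < N) (2 ^+ k.+1)^-1 <= 1 :> R.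
Proof.
suff -> : \sum_(k < N) (2 ^+ k.+1)^-1 = 1 - (2 ^+ N)^-1 :> R.
  by rewrite lerBlDr lerDl invr_ge0 exprn_ge0.
elim: N => [|N IH]; first by rewrite big_ord0 expr0 invr1 subrr.
rewrite big_ord_recr/= IH exprS; field; exact: expf_neq0.
Qed.

End SummationByParts.

(** * The logarithmic potential of the product over dyadic scales *)

Section NormalGrowth.
Context {R : realType}.
Notation C := R[i].

(** The logarithm of the modulus of [quad_factor s] at the real point [t], where [x = t / s]. *)
Definition quartic_log (x : R) : R := ln (1 + x ^+ 4 / 4) / 2.

Let arg_ge1 (x : R) : 1 <= 1 + x ^+ 4 / 4.
Proof. by rewrite lerDl divr_ge0// -[4%N]/(2 * 2)%N exprM sqr_ge0. Qed.

Let arg_gt0 (x : R) : 0 < 1 + x ^+ 4 / 4.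
Proof. by apply: lt_le_trans (arg_ge1 x). Qed.

Lemma quartic_log_ge0 x : 0 <= quartic_log x.
Proof. by rewrite divr_ge0// ln_ge0. Qed.

Lemma quartic_log_le x : quartic_log x <= x ^+ 4 / 8.
Proof.
have := @le_ln1Dx R (x ^+ 4 / 4); rewrite /quartic_log.
have := arg_ge1 x => h1 /(_ _) h2.
have : ln (1 + x ^+ 4 / 4) <= x ^+ 4 / 4 by apply: h2; lra.
lra.
Qed.

Lemma ler_quartic_log x y : 0 <= x -> x <= y -> quartic_log x <= quartic_log y.
Proof.
move=> x0 xy; rewrite ler_pM2r// ler_ln ?posrE// lerD2l ler_pM2r//.
by apply: lerXn2r => //; rewrite nnegrE// (le_trans x0).
Qed.

Lemma expR1_ge2 : (2 : R) <= expR 1.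
Proof. by have := @expR_ge1Dx R 1. Qed.

(** Doubling the argument multiplies [1 + x^4 / 4] by at most [16 <= e^4]. *)
Lemma quartic_log_half x : quartic_log x - quartic_log (x / 2) <= 2.
Proof.
suff h : ln (1 + x ^+ 4 / 4) <= ln (1 + (x / 2) ^+ 4 / 4) + 4 by rewrite /quartic_log; lra.
rewrite -[X in _ <= _ + X](@expRK R) -lnM ?posrE ?expR_gt0// ler_ln ?posrE ?mulr_gt0 ?expR_gt0//.
have e4 : 16 <= expR 4 :> R.
  have -> : expR 4 = expR 1 ^+ 4 :> R by rewrite -expRM_natl mulr1.
  have -> : 16 = 2 ^+ 4 :> R by rewrite -natrX.
  by apply: lerXn2r; rewrite ?nnegrE ?expR_ge0// expR1_ge2.
have q0 : 0 <= x ^+ 4 by rewrite -[4%N]/(2 * 2)%N exprM sqr_ge0.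
apply: (@le_trans _ _ ((1 + (x / 2) ^+ 4 / 4) * 16)); last by rewrite ler_pM2l.
by rewrite (_ : (x / 2) ^+ 4 = x ^+ 4 / 16); [lra|field].
Qed.

Lemma quartic_log_le_ln x : 1 <= x -> quartic_log x <= 2 * ln x + 1.
Proof.
move=> x1; have x0 : 0 < x by lra.
suff h : ln (1 + x ^+ 4 / 4) <= ln (x ^+ 4) + 2.
  by move: h; rewrite lnXn// /quartic_log -[ln x *+ 4]mulr_natr; lra.
rewrite -[X in _ <= _ + X](@expRK R) -lnM ?posrE ?expR_gt0 ?exprn_gt0// ler_ln ?posrE ?mulr_gt0 ?expR_gt0 ?exprn_gt0//.
have e2 : 2 <= expR 2 :> R by apply: (le_trans expR1_ge2); rewrite ler_expR; lra.
have x4 : 1 <= x ^+ 4 by rewrite exprn_ege1.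
by nra.
Qed.

Lemma expR_quartic_log x : expR (quartic_log x) = Num.sqrt (1 + x ^+ 4 / 4).
Proof.
rewrite -[LHS]ger0_norm ?expR_ge0// -sqrtr_sqr expr2 -expRD; congr Num.sqrt.
by rewrite /quartic_log -mulrDr (_ : _ * _ = ln (1 + x ^+ 4 / 4)) ?lnK ?posrE//; field.
Qed.

(* The Taylor polynomial of [exp (- i z / s)]: on the real line its modulus is
   [sqrt (1 + x ^ 4 / 4)], without quadratic term, so that the growth
   [phi x = O(x ^ 2)] is enough to sum the contributions of large [s]. *)
Definition quad_factor (s : R) : {poly C} :=
  1 - (Complex 0 s^-1)%:P * 'X - ((2 * s ^+ 2)^-1)%:C%C%:P * 'X^2.

Lemma size_quad_factor s : (size (quad_factor s) <= 3)%N.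
Proof.
rewrite /quad_factor !mul_polyC.
rewrite (leq_trans (size_polyD _ _))// geq_max size_polyN; apply/andP; split.
  rewrite (leq_trans (size_polyD _ _))// geq_max size_polyN size_poly1/=.
  by rewrite (leq_trans (size_scale_leq _ _))// size_polyX.
by rewrite (leq_trans (size_scale_leq _ _))// size_polyXn.
Qed.

Lemma cabs_quad_factor s t : s != 0 ->
  cabs (quad_factor s).[(t%:C)%C] = expR (quartic_log (t / s)).
Proof.
move=> s0; rewrite /quad_factor !hornerE expR_quartic_log.
rewrite (_ : _ - _ = Complex (1 - (t / s) ^+ 2 / 2) (- (t / s))); last first.
  by apply/eqP; rewrite eq_complex/=; apply/andP; split; apply/eqP; field.
by rewrite /cabs/= /ComplexField.Normc.normc/=; congr Num.sqrt; field.
Qed.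

Lemma cabs_quad_factor_i s : 0 < s -> 1 + s^-1 <= cabs (quad_factor s).['i%C].
Proof.
move=> s0; apply: le_trans (Re_le_cabs _).
rewrite /quad_factor !hornerE/= !(mul0r, mulr0, add0r, addr0, sub0r, subr0, mulr1, mul1r).
have : 0 < (2 * s ^+ 2)^-1 by rewrite invr_gt0 mulr_gt0// exprn_gt0.
lra.
Qed.

Variables (phi : R -> R) (A : R).
Hypotheses (mono : forall x y : R, 0 <= x -> x <= y -> phi x <= phi y)
  (phi_gt0 : forall x : R, 0 <= x -> 0 < phi x) (A1 : 1 <= A)
  (quad : forall x y, A <= x -> x <= y -> phi y * x ^+ 2 <= phi x * y ^+ 2)
  (conv_ext : forall x t, A <= x -> 2 * x <= t ->
     (phi (2 * x) - phi x) * ln (t / (2 * x)) <= phi t - phi (2 * x)).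

Lemma doubling x : A <= x -> phi (2 * x) <= 4 * phi x.
Proof.
move=> Ax; have hA := A1; have x0' : 0 < x by lra.
have x0 : 0 < x ^+ 2 by rewrite exprn_gt0.
have h : phi (2 * x) * x ^+ 2 <= phi x * (2 * x) ^+ 2 by apply: quad => //; lra.
by rewrite -(ler_pM2r x0) (le_trans h)// le_eqVlt; apply/orP; left; apply/eqP; ring.
Qed.

(* Each Abel term is dominated by the increment of a potential, whose first
   part pays for the scales [s <= t] and whose second part for the others. *)
Lemma abel_term_le (s t : R) : A <= s -> A <= t ->
  (phi (2 * s) - phi s) * (quartic_log (t / s) - quartic_log (t / (2 * s))) <=
  (2 * Num.min (phi (2 * s)) (4 * phi t) - 3 * phi t * Num.min 1 ((t / (2 * s)) ^+ 2)) -
  (2 * Num.min (phi s) (4 * phi t) - 3 * phi t * Num.min 1 ((t / s) ^+ 2)).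
Proof.
move=> As At; have hA := A1; have s0 : 0 < s by lra. have t0 : 0 < t by lra.
have pt := phi_gt0 t (ltW t0); have ps := phi_gt0 s (ltW s0).
have D0 : 0 <= phi (2 * s) - phi s by rewrite subr_ge0 mono//; lra.
set x := t / s; have x0 : 0 < x by rewrite divr_gt0.
have hx : t / (2 * s) = x / 2 by rewrite /x invfM; ring.
rewrite hx.
have m1 : Num.min 1 ((x / 2) ^+ 2) <= Num.min 1 (x ^+ 2).
  rewrite le_min ge_min lexx/= ge_min; apply/orP; right.
  by rewrite expr_div_n ler_pdivrMr ?exprn_gt0// ler_peMr ?sqr_ge0//; lra.
(* For [s <= t], doubling keeps the first minimum below its cap, and the term is at most
   [2 (phi(2 s) - phi s)]. *)
have [st|ts] := leP s t.
  have l2 := quartic_log_half x.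
  have p4 : phi (2 * s) <= 4 * phi t by apply: (le_trans (doubling _ As)); rewrite ler_pM2l// mono// ltW.
  rewrite (min_l p4) (min_l (_ : phi s <= 4 * phi t)); last by lra.
  by nra.
(* For [s > t], quadratic growth bounds the term by [phi t * x^2 / 2], and the second part of the
   potential gains [3 phi t (x^2 - x^2 / 4)]. *)
have x1 : x < 1 by rewrite ltr_pdivrMr ?mul1r.
have mm : Num.min (phi s) (4 * phi t) <= Num.min (phi (2 * s)) (4 * phi t).
  by rewrite le_min !ge_min lexx orbT andbT; apply/orP; left; lra.
rewrite [Num.min 1 (x ^+ 2)]min_r; last by rewrite exprn_ile1// ltW.
rewrite [Num.min 1 ((x / 2) ^+ 2)]min_r; last by rewrite exprn_ile1//; lra.
have q := quartic_log_le x; have q0 := quartic_log_ge0 (x / 2).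
have D1 : (phi (2 * s) - phi s) * x ^+ 2 <= 4 * phi t.
  have := quad t (2 * s) At _; rewrite (_ : (2 * s) ^+ 2 = 4 * s ^+ 2); last by ring.
  have s20 : 0 < s ^+ 2 by rewrite exprn_gt0.
  move=> /(_ _) h; have {}h : phi (2 * s) * t ^+ 2 <= phi t * (4 * s ^+ 2) by apply: h; lra.
  rewrite /x expr_div_n mulrA ler_pdivrMr//.
  have : phi s * t ^+ 2 >= 0 by rewrite mulr_ge0 ?sqr_ge0// ltW.
  by lra.
have x2 : 0 <= x ^+ 2 by exact: sqr_ge0.
apply: (@le_trans _ _ ((phi (2 * s) - phi s) * (x ^+ 4 / 8))).
  by rewrite ler_wpM2l//; lra.
have -> : (phi (2 * s) - phi s) * (x ^+ 4 / 8) = ((phi (2 * s) - phi s) * x ^+ 2) * (x ^+ 2 / 8) by ring.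
apply: (@le_trans _ _ (4 * phi t * (x ^+ 2 / 8))); first by rewrite ler_wpM2r//; lra.
have -> : (x / 2) ^+ 2 = x ^+ 2 / 4 by field.
have : 0 <= phi t * x ^+ 2 by rewrite mulr_ge0// ltW.
by lra.
Qed.

Variables (b : R) (N : nat).
Hypothesis Ab : A <= b.
Let f k := phi (b * 2 ^+ k).
Let s_ge k : A <= b * 2 ^+ k.
Proof. have hA := A1; have hb := Ab; by rewrite (le_trans Ab)// ler_peMr ?exprn_ege1 ?ler1n//; lra. Qed.
Let sS k : b * 2 ^+ k.+1 = 2 * (b * 2 ^+ k).
Proof. by rewrite exprS; ring. Qed.

(** [14 = 8 + 3 + 3]: the potential telescopes between at most [8 phi t] and at least [- 3 phi t],
    and the last boundary term of the summation by parts is at most [3 phi t]. *)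
Lemma potential_le (t : R) : A <= t ->
  \sum_(k < N) ((f k.+2 - f k.+1) - (f k.+1 - f k)) * quartic_log (t / (b * 2 ^+ k.+1))
  <= 14 * phi t.
Proof.
move=> At; have hA := A1; have t0 : 0 < t by lra.
have pt := phi_gt0 t (ltW t0).
have s0 k : 0 < b * 2 ^+ k by have := s_ge k; lra.
have D0 k : 0 <= f k.+1 - f k by rewrite subr_ge0 mono ?ltW// sS; have := s0 k; lra.
apply: le_trans (abel_le f (fun k => quartic_log (t / (b * 2 ^+ k))) N _) _.
  by rewrite mulr_ge0 ?quartic_log_ge0.
have V : \sum_(k < N) (f k.+2 - f k.+1) * (quartic_log (t / (b * 2 ^+ k.+1)) -
     quartic_log (t / (b * 2 ^+ k.+2))) <= 11 * phi t.
  pose Phi k := 2 * Num.min (f k) (4 * phi t) - 3 * phi t * Num.min 1 ((t / (b * 2 ^+ k)) ^+ 2).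
  apply: (@le_trans _ _ (\sum_(k < N) (Phi k.+2 - Phi k.+1))).
    apply: ler_sum => k _; rewrite /Phi /f [b * 2 ^+ k.+2]sS.
    exact: abel_term_le.
  rewrite -(big_mkord xpredT (fun k => Phi k.+2 - Phi k.+1)).
  rewrite (telescope_sumr (fun k => Phi k.+1))//.
  have h1 : Phi N.+1 <= 8 * phi t.
    have : Num.min (f N.+1) (4 * phi t) <= 4 * phi t by rewrite ge_min lexx orbT.
    have : 0 <= Num.min 1 ((t / (b * 2 ^+ N.+1)) ^+ 2) by rewrite le_min ler01 sqr_ge0.
    by rewrite /Phi; nra.
  have h2 : - 3 * phi t <= Phi 1%N.
    have : 0 <= Num.min (f 1%N) (4 * phi t) by rewrite le_min !ltW ?mulr_gt0// phi_gt0// ltW.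
    have : Num.min 1 ((t / (b * 2 ^+ 1)) ^+ 2) <= 1 by rewrite ge_min lexx.
    by rewrite /Phi; nra.
  by lra.
suff : (f N.+1 - f N) * quartic_log (t / (b * 2 ^+ N.+1)) <= 3 * phi t by lra.
set a := b * 2 ^+ N.+1; have a0 : 0 < a by exact: s0.
have fN : 0 < f N by exact: phi_gt0 (ltW (s0 N)).
have DN := D0 N.
have [ta|at_] := leP t a.
  have h := quad t a At ta.
  set x := t / a; have x0 : 0 < x by rewrite divr_gt0.
  have x1 : x <= 1 by rewrite ler_pdivrMr ?mul1r.
  have h' : f N.+1 * x ^+ 2 <= phi t.
    by rewrite /x expr_div_n mulrA ler_pdivrMr ?exprn_gt0.
  have x21 : x ^+ 2 <= 1 by rewrite exprn_ile1// ltW.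
  have x20 : 0 <= x ^+ 2 by exact: sqr_ge0.
  have q := quartic_log_le x.
  apply: (@le_trans _ _ (f N.+1 * (x ^+ 4 / 8))).
    apply: ler_pM => //; first exact: quartic_log_ge0.
    by rewrite gerBl ltW.
  have -> : f N.+1 * (x ^+ 4 / 8) = (f N.+1 * x ^+ 2) * (x ^+ 2 / 8) by ring.
  by nra.
(* Beyond the last scale the boundary term grows like [2 ln (t / a)]; convexity makes [phi t] grow
   at least as fast as the slope [f N.+1 - f N] times this logarithm. *)
have c := conv_ext _ t (s_ge N); rewrite -sS -/a -/(f N) -/(f N.+1) in c.
have {}c := c (ltW at_).
have x1 : 1 <= t / a by rewrite ler_pdivlMr ?mul1r ?ltW.
have q := quartic_log_le_ln _ x1.
have fa : f N.+1 <= phi t by rewrite mono ?ltW.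
apply: (@le_trans _ _ ((f N.+1 - f N) * (2 * ln (t / a) + 1))); first by rewrite ler_wpM2l.
by lra.
Qed.

End NormalGrowth.

(** * The minorant polynomial under normal growth *)

Section NormalPolynomial.
Context {R : realType}.
Notation C := R[i].

(** The degree is at most the telescoping sum of [D k / 14], hence at most [phi a = n]. At [i] a
    factor is at least [1 + 1 / s >= e^(1 / (2 s))], and [sum_second_difference] returns half of the
    dyadic sum: [56 = 2 * 28]. *)
Lemma normal_minorant (phi : R -> R) (A b : R) (N n : nat) :
  (forall x y : R, 0 <= x -> x <= y -> phi x <= phi y) ->
  (forall x : R, 0 <= x -> 0 < phi x) -> 1 <= A ->
  (forall x y, A <= x -> x <= y -> phi y * x ^+ 2 <= phi x * y ^+ 2) ->
  (forall x, A <= x -> 2 * phi (2 * x) <= phi x + phi (2 * (2 * x))) ->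
  (forall x t, A <= x -> 2 * x <= t ->
     (phi (2 * x) - phi x) * ln (t / (2 * x)) <= phi t - phi (2 * x)) ->
  A <= b -> phi (b * 2 ^+ N.+1) = n%:R ->
  exists P : {poly C}, [/\ (size P <= n.+1)%N,
    forall t : R, cabs P.[(t%:C)%C] <= expR (phi b / 2) * expR (phi `|t| / 2) &
    expR ((dyadic_sum phi b N.+1 / 56 - phi (2 * b) / 28 - 1) / 2) <= cabs P.['i%C]].
Proof.
move=> mono phi_gt0 A1 quad conv_mid conv_ext Ab phia.
have b1 : 1 <= b by lra.
have s1 k : 1 <= b * 2 ^+ k.
  by rewrite (le_trans b1)// ler_peMr ?exprn_ege1 ?ler1n//; lra.
have s0 k : 0 < b * 2 ^+ k by have := s1 k; lra.
have sA k : A <= b * 2 ^+ k.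
  by rewrite (le_trans Ab)// ler_peMr ?exprn_ege1 ?ler1n//; lra.
have sS k : b * 2 ^+ k.+1 = 2 * (b * 2 ^+ k) by rewrite exprS; ring.
pose f k := phi (b * 2 ^+ k).
have f0 k : 0 < f k by exact: phi_gt0 (ltW (s0 k)).
pose D k := (f k.+2 - f k.+1) - (f k.+1 - f k).
have D0 k : 0 <= D k.
  have := conv_mid _ (sA k); rewrite -!sS -/(f _) -/(f _) -/(f _) /D; lra.
(* [28 = 2 * 14], so that [potential_le] leaves [phi t / 2]. *)
pose m k := Num.truncn (D k / 28).
have m_le k : (m k)%:R <= D k / 28 by rewrite truncn_le divr_ge0.
have m_ge k : D k / 28 - 1 <= (m k)%:R.
  by rewrite lerBlDr natr1 ltW// truncnS_gt.
pose P : {poly C} := \prod_(k < N) quad_factor (b * 2 ^+ k.+1) ^+ m k.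
exists P; split.
- have sP : (size P <= (\sum_(k < N) 2 * m k).+1)%N.
    rewrite /P; elim: (N) => [|K IH]; first by rewrite !big_ord0 size_poly1.
    rewrite !big_ord_recr/= (leq_trans (size_polyMleq _ _))//.
    have sq : (size (quad_factor (b * 2 ^+ K.+1) ^+ m K) <= (2 * m K).+1)%N.
      elim: (m K) => [|j IHj]; first by rewrite expr0 size_poly1.
      rewrite exprS (leq_trans (size_polyMleq _ _))//.
      rewrite -subn1 leq_subLR (leq_trans (leq_add (size_quad_factor _) IHj))//.
      by rewrite mulnS; lia.
    by rewrite -subn1 leq_subLR (leq_trans (leq_add IH sq))// addSn addnS.
  rewrite (leq_trans sP)// ltnS -(@ler_nat R) natr_sum -phia.
  apply: (@le_trans _ _ (\sum_(k < N) D k / 14)).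
    by apply: ler_sum => k _; rewrite natrM; have := m_le k; lra.
  rewrite -mulr_suml -(big_mkord xpredT D) /D.
  rewrite (telescope_sumr (fun k => f k.+1 - f k))//.
  have m1 : f 0%N <= f 1%N by rewrite mono ?ltW//; rewrite sS; have := s0 0%N; lra.
  have := f0 N; have := f0 N.+1; rewrite -/(f N.+1). lra.
- have main (t : R) : b <= t -> \sum_(k < N) (m k)%:R * quartic_log (t / (b * 2 ^+ k.+1)) <= phi t / 2.
    move=> bt; have := potential_le phi A mono phi_gt0 A1 quad conv_ext b N Ab t (le_trans Ab bt).
    move=> h; apply: (@le_trans _ _ ((14 * phi t) / 28)); last lra.
    rewrite ler_pdivlMr// mulr_suml; apply: le_trans h; apply: ler_sum => k _.
    rewrite -/(f _) -/(f _) -/(f _) -/(D k).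
    have q := quartic_log_ge0 (t / (b * 2 ^+ k.+1)).
    by have := m_le k; nra.
  move=> t.
  have -> : cabs P.[(t%:C)%C] = expR (\sum_(k < N) (m k)%:R * quartic_log (`|t| / (b * 2 ^+ k.+1))).
    rewrite /P horner_prod cabs_prod expR_sum; apply: eq_bigr => k _.
    rewrite horner_exp cabsX cabs_quad_factor ?gt_eqF// expRM_natl; congr (expR _ ^+ _).
    rewrite /quartic_log -[4%N]/(2 * 2)%N !exprM; congr (ln (1 + _ ^+ 2 / _) / _).
    by rewrite !expr_div_n real_normK ?num_real.
  rewrite -expRD ler_expR.
  (* Below [b] the potential is increasing in [|t|] and is bounded by its value at [b], whence the
     factor [e^(phi b / 2)]. *)
  have [bt|tb] := leP b `|t|.
    by apply: (le_trans (main _ bt)); rewrite lerDr divr_ge0// ltW// phi_gt0//; lra.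
  apply: (@le_trans _ _ (\sum_(k < N) (m k)%:R * quartic_log (b / (b * 2 ^+ k.+1)))).
    apply: ler_sum => k _; rewrite ler_wpM2l//; apply: ler_quartic_log.
      by rewrite divr_ge0// ltW.
    by rewrite ler_pM2r ?invr_gt0// ltW.
  by apply: (le_trans (main _ (lexx b))); rewrite lerDl divr_ge0// ltW// phi_gt0.
rewrite /P horner_prod cabs_prod.
apply: (@le_trans _ _ (expR (\sum_(k < N) (m k)%:R * ((b * 2 ^+ k.+1)^-1 / 2)))); last first.
  rewrite expR_sum; apply: ler_prod => k _; rewrite expR_ge0/= horner_exp cabsX expRM_natl.
  apply: lerXn2r; rewrite ?nnegrE ?expR_ge0 ?cabs_ge0//.
  apply: le_trans (cabs_quad_factor_i _ (s0 k.+1)).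
  apply: expR_half_le; first by rewrite invr_ge0 ltW.
  by rewrite invf_le1.
rewrite ler_expR.
have -> : \sum_(k < N) (m k)%:R * ((b * 2 ^+ k.+1)^-1 / 2) =
   (\sum_(k < N) (m k)%:R / (2 ^+ k.+1)) * (b^-1 / 2).
  by rewrite mulr_suml; apply: eq_bigr => k _; rewrite invfM; ring.
have sd := sum_second_difference f N.
have sh := @sum_half_exp_le1 R N.
(* Rounding down loses at most 1 per scale, with weights [2^(- k - 1)]: at most 1 in total. *)
have lower : (\sum_(k < N) D k / 2 ^+ k.+1) / 28 - 1 <= \sum_(k < N) (m k)%:R / (2 ^+ k.+1).
  apply: (@le_trans _ _ (\sum_(k < N) (D k / 28 - 1) / 2 ^+ k.+1)); last first.
    by apply: ler_sum => k _; rewrite ler_pM2r ?invr_gt0 ?exprn_gt0.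
  have -> : \sum_(k < N) (D k / 28 - 1) / 2 ^+ k.+1 =
      (\sum_(k < N) D k / 2 ^+ k.+1) / 28 - \sum_(k < N) (2 ^+ k.+1)^-1.
    rewrite mulr_suml -sumrB; apply: eq_bigr => k _; ring.
  by rewrite lerD2l lerN2.
have dS : dyadic_sum phi b N.+1 = b^-1 * (\sum_(k < N.+1) f k.+1 / 2 ^+ k.+1).
  by rewrite /dyadic_sum mulr_sumr; apply: eq_bigr => k _; rewrite -/(f _) invfM; ring.
have S0 : 0 <= \sum_(k < N.+1) f k.+1 / 2 ^+ k.+1.
  by apply: sumr_ge0 => k _; rewrite divr_ge0 ?exprn_ge0// ltW.
have half : (\sum_(k < N.+1) f k.+1 / 2 ^+ k.+1) / 2 - f 1%N <= \sum_(k < N) D k / 2 ^+ k.+1.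
  rewrite /D sd big_ord_recr/=.
  have m1 : f N <= f N.+1 by rewrite mono ?ltW//; rewrite sS; have := s0 N; lra.
  have q : f N.+1 / 2 ^+ N.+1 <= (2 * f N.+1 - f N) / 2 ^+ N.+1.
    by rewrite ler_pM2r ?invr_gt0 ?exprn_gt0//; lra.
  have q0 : 0 <= f N.+1 / 2 ^+ N.+1 by rewrite divr_ge0 ?exprn_ge0// ltW.
  have := f0 0%N; lra.
have f1 : f 1%N = phi (2 * b) by rewrite /f expr1 mulrC.
rewrite dS -f1.
move: (\sum_(k < N.+1) _) (\sum_(k < N) _) (\sum_(k < N) _) lower half S0 => S X Y h1 h2 S0.
have ib0 : 0 < b^-1 by rewrite invr_gt0; lra.
have ib1 : b^-1 <= 1 by rewrite invf_le1//; lra.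
have f10 := f0 1%N.
rewrite mulrCA mulrC mulrA -[leRHS]mulrA; nra.
Qed.

(** The point [2 x] is the geometric mean of [x] and [4 x]. *)
Lemma convex_log_mid (phi : R -> R) (A x : R) : 0 < A ->
  convex_from (ln A) (fun t => phi (expR t)) -> A <= x ->
  2 * phi (2 * x) <= phi x + phi (2 * (2 * x)).
Proof.
move=> A0 cvx Ax; have x0 : 0 < x by lra.
have l2 : 0 <= ln (2 : R) by rewrite ln_ge0//; lra.
have lx : ln A <= ln x by rewrite ler_ln.
have E2 : ln (2 * x) = ln 2 + ln x by rewrite lnM ?posrE.
have E4 : ln (2 * (2 * x)) = ln 2 + (ln 2 + ln x) by rewrite lnM ?posrE ?mulr_gt0// E2.
have := cvx (ln x) (ln (2 * (2 * x))) (2^-1) lx.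
rewrite !lnK ?posrE ?mulr_gt0// => h.
have {}h := h _ _; rewrite (_ : 2^-1 * _ + _ = ln (2 * x)) in h; last by rewrite E4 E2; field.
rewrite lnK ?posrE ?mulr_gt0// in h.
by have := h _ _; rewrite E4 => {}h; have := h ltac:(lra) ltac:(lra); lra.
Qed.

(** Beyond [2 x] the function lies above the chord through [x] and [2 x], of slope
    [(phi(2 x) - phi x) / ln 2] in the logarithm; [ln 2 <= 1] removes the denominator. *)
Lemma convex_log_ext (phi : R -> R) (A x t : R) : 0 < A ->
  (forall x y : R, 0 <= x -> x <= y -> phi x <= phi y) ->
  convex_from (ln A) (fun t => phi (expR t)) -> A <= x -> 2 * x <= t ->
  (phi (2 * x) - phi x) * ln (t / (2 * x)) <= phi t - phi (2 * x).
Proof.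
move=> A0 mono cvx Ax xt; have x0 : 0 < x by lra.
have t0 : 0 < t by lra.
have l20 : 0 < ln (2 : R) by rewrite ln_gt0//; lra.
have l21 : ln (2 : R) <= 1 by have := @le_ln1Dx R 1; rewrite -[1 + 1]/2; apply; lra.
set la := ln (t / (2 * x)).
have la0 : 0 <= la by rewrite ln_ge0// ler_pdivlMr ?mulr_gt0// mul1r.
have tE : ln t = ln x + (ln 2 + la).
  rewrite -[t in LHS](@divfK _ (2 * x)) ?gt_eqF ?mulr_gt0// lnM ?posrE ?divr_gt0 ?mulr_gt0//.
  by rewrite lnM ?posrE// -/la; ring.
have lx : ln A <= ln x by rewrite ler_ln.
have L0 : 0 < ln 2 + la by lra.
have := cvx (ln x) (ln t) (la / (ln 2 + la)) lx.
have -> : la / (ln 2 + la) * ln x + (1 - la / (ln 2 + la)) * ln t = ln 2 + ln x.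
  by rewrite tE; field; rewrite gt_eqF.
rewrite -lnM ?posrE// !lnK ?posrE ?mulr_gt0// => h.
have {}h : phi (2 * x) <= la / (ln 2 + la) * phi x + (1 - la / (ln 2 + la)) * phi t.
  apply: h; first by rewrite tE; lra.
  by rewrite divr_ge0 ?(ltW L0)//= ler_pdivrMr// mul1r; lra.
have {}h : phi (2 * x) * (ln 2 + la) <= la * phi x + ln 2 * phi t.
  apply: (le_trans (ler_wpM2r (ltW L0) h)); rewrite le_eqVlt; apply/orP; left; apply/eqP.
  by field; rewrite gt_eqF.
have m : phi (2 * x) <= phi t by rewrite mono//; lra.
by nra.
Qed.

End NormalPolynomial.

(** * Dyadic sums and logarithmic integrals *)

Section IntegralComparison.
Context {R : realType}.
Notation mu := (@lebesgue_measure R).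
Variable phi : R -> R.
Hypotheses (cphi : continuous (fun t : R => phi `|t|))
  (mono : forall x y : R, 0 <= x -> x <= y -> phi x <= phi y)
  (phi_gt0 : forall x : R, 0 <= x -> 0 < phi x).

Definition log_integral (x : R) : R :=
  (\int[mu]_(t in `[0, x]) (phi t / (t ^+ 2 + 1)))%R.

Let h (t : R) := phi `|t| / (1 + t ^+ 2).

Let ch : continuous h.
Proof. by move=> t; apply: cvgM; [exact: cphi|exact: continuous_oneDsqrV]. Qed.

Let log_integralE x : log_integral x = (\int[mu]_(t in `[0, x]) h t)%R.
Proof.
apply: eq_Rintegral => t; rewrite inE/= in_itv/= => /andP[t0 _].
by rewrite /h ger0_norm// addrC.
Qed.

Lemma log_integralB_bounds x y : 0 <= x -> x < y ->
  phi x * (y - x) / (1 + y ^+ 2) <= log_integral y - log_integral x <=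
  phi y * (y - x) / (1 + x ^+ 2).
Proof.
move=> x0 xy; rewrite !log_integralE Rintegral_itvB ?bnd_simp; last 3 first.
- by apply: continuous_compact_integrable; [exact: segment_compact|exact: continuous_subspaceT].
- exact: x0.
- exact: ltW.
have mxy : (lebesgue_measure (`]x, y] : set R) = (y - x)%:E)%E.
  by rewrite lebesgue_measure_itv/= lte_fin xy EFinB.
have ic (g : R -> R) : continuous g -> mu.-integrable `]x, y] (EFin \o g).
  move=> cg; have sub : `]x, y] `<=` (`[x, y] : set R) by apply: subset_itv; rewrite bnd_simp.
  have ig : mu.-integrable `[x, y] (EFin \o g).
    by apply: continuous_compact_integrable; [exact: segment_compact|exact: continuous_subspaceT].
  exact: integrableS ig.
have ih := ic h ch.
have {}ic c : mu.-integrable `]x, y] (EFin \o cst c) by apply: ic => ?; exact: cvg_cst.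
have Ic c : (\int[mu]_(t in `]x, y]) (cst c t))%R = c * (y - x).
  rewrite Rintegral_cst//; congr (c * _).
  exact: (congr1 (@fine R) mxy).
have sq (u v : R) : 0 <= u -> u <= v -> 1 + u ^+ 2 <= 1 + v ^+ 2.
  by move=> u0 uv; rewrite lerD2l lerXn2r ?nnegrE//; lra.
apply/andP; split.
  rewrite mulrAC -Ic; apply: le_Rintegral => // t; rewrite /= in_itv/= => /andP[xt ty].
  rewrite /h ger0_norm; last lra.
  apply: ler_pM; rewrite ?invr_ge0 ?(ltW (oneDsqr_gt0 _)) ?(ltW (phi_gt0 _ x0))//.
    by rewrite mono// ltW.
  by rewrite lef_pV2 ?posrE ?oneDsqr_gt0// sq//; lra.
rewrite mulrAC -Ic; apply: le_Rintegral => // t; rewrite /= in_itv/= => /andP[xt ty].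
have t0 : 0 <= t by lra.
rewrite /h ger0_norm//.
apply: ler_pM; rewrite ?invr_ge0 ?(ltW (oneDsqr_gt0 _)) ?(ltW (phi_gt0 _ t0))//.
  by rewrite mono.
by rewrite lef_pV2 ?posrE ?oneDsqr_gt0// sq//; lra.
Qed.

Lemma log_integral0 : log_integral 0 = 0.
Proof. by rewrite /log_integral set_itv1 Rintegral_set1. Qed.

Lemma ler_log_integral x y : 0 <= x -> x <= y -> log_integral x <= log_integral y.
Proof.
move=> x0; rewrite le_eqVlt => /predU1P[->//|xy].
have /andP[l _] := log_integralB_bounds _ _ x0 xy.
rewrite -subr_ge0; apply: le_trans l.
by rewrite divr_ge0 ?(ltW (oneDsqr_gt0 _))// mulr_ge0 ?(ltW (phi_gt0 _ x0))// subr_ge0 ltW.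
Qed.

(** Allows the additive constants of the normal case to be absorbed into the logarithmic
    integral. *)
Lemma log_integral_unbounded :
  (\int[mu]_(t in `[0%R, +oo[) (phi t / (1 + t ^+ 2))%:E = +oo)%E ->
  forall B, exists2 X, 0 <= X & forall x, X <= x -> B <= log_integral x.
Proof.
move=> Ioo B.
suff [X X0 XB] : exists2 X, 0 <= X & B <= log_integral X.
  by exists X => // x Xx; rewrite (le_trans XB)// ler_log_integral.
apply: contrapT => hB.
have lt x : 0 <= x -> log_integral x <= B.
  by move=> x0; rewrite leNgt; apply/negP => /ltW Bx; apply: hB; exists x.
have E : `[0%R, +oo[%classic = \bigcup_(n in [set: nat]) `[0, n%:R]%classic :> set R.
  apply/seteqP; split => t /=.
    rewrite in_itv/= andbT => t0; exists (Num.bound t) => //=.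
    by rewrite in_itv/= t0/= ltW// archi_boundP.
  by move=> [n _]; rewrite /= !in_itv/= andbT => /andP[].
have cv : ((\int[mu]_(x in `[0%R, i%:R]) (h x)%:E)%E @[i --> \oo] --> (+oo)%E).
  rewrite -Ioo E (_ : (\int[mu]_(t in _) (phi t / _)%:E)%E = (\int[mu]_(t in \bigcup_(n in [set: nat]) `[0%R, n%:R]%classic) (h t)%:E)%E); last first.
    apply: eq_integral => t; rewrite -E inE/= in_itv/= andbT => t0.
    by rewrite /h ger0_norm.
  apply: (@ge0_nondecreasing_set_cvg_integral _ (measurableTypeR R) R (fun n : nat => `[0, n%:R]%classic) (fun t => (h t)%:E) mu).
  - move=> i j ij; apply/subsetPset; apply: subset_itvl; rewrite bnd_simp ler_nat//.
  - by move=> i; exact: measurable_itv.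
  - move=> i; apply: measurable_funTS; apply/measurable_EFinP; exact: continuous_measurable_fun.
  - by move=> n x _; rewrite lee_fin divr_ge0 ?(ltW (oneDsqr_gt0 _))// ltW// phi_gt0.
have : (+oo <= B%:E)%E.
  apply: (cvge_le _ cv); apply: nearW => n.
  have := lt n%:R (ler0n _ _); rewrite log_integralE => hh.
  rewrite -[leLHS]fineK; first by rewrite lee_fin.
  apply: integrable_fin_num => //.
  by apply: continuous_compact_integrable; [exact: segment_compact|exact: continuous_subspaceT].
by rewrite leye_eq.
Qed.

Lemma dyadic_sum_recr b J : dyadic_sum phi b J.+1 =
  dyadic_sum phi b J + phi (b * 2 ^+ J.+1) / (b * 2 ^+ J.+1).
Proof. by rewrite /dyadic_sum big_ord_recr. Qed.

(** The sum samples [phi] at [2 s], while the integral over [[s, 2 s]] only guarantees [phi s];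
    doubling bridges the gap, and the rest of the 16 covers [1 + (2 s)^2] against [s^2], as
    [s >= 1]. *)
Lemma dyadic_sum_le_log_integral b J : 1 <= b ->
  (forall x, b <= x -> phi (2 * x) <= 4 * phi x) ->
  dyadic_sum phi b J <= 16 * log_integral (b * 2 ^+ J).
Proof.
move=> b1 dbl; have b0 : 0 < b by lra.
have sb k : b <= b * 2 ^+ k by rewrite ler_peMr ?exprn_ege1 ?ler1n//; lra.
elim: J => [|J IH].
  rewrite /dyadic_sum big_ord0 mulr_ge0//.
  by rewrite -log_integral0 ler_log_integral// mulr_ge0// ?exprn_ge0// ltW.
rewrite dyadic_sum_recr (_ : b * 2 ^+ J.+1 = 2 * (b * 2 ^+ J)); last by rewrite exprS; ring.
have := sb J; move: (b * 2 ^+ J) IH => s IH bs.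
have s0 : 0 < s by lra.
have /andP[l _] := log_integralB_bounds s (2 * s) (ltW s0) ltac:(lra).
have ps := phi_gt0 s (ltW s0); have d := dbl s bs.
suff : phi (2 * s) / (2 * s) <= 16 * (phi s * (2 * s - s) / (1 + (2 * s) ^+ 2)) by lra.
rewrite ler_pdivrMr ?mulr_gt0// [leRHS](_ : _ = phi s * (32 * s ^+ 2 / (1 + (2 * s) ^+ 2))); last by ring.
apply: (le_trans d); rewrite [leLHS]mulrC ler_pM2l//. rewrite (ler_pdivlMr _ _ (oneDsqr_gt0 (2 * s))).
have : 1 <= s ^+ 2 by rewrite exprn_ege1//; lra.
by rewrite exprMn; lra.
Qed.

Lemma log_integral_le_dyadic_sum b J : 0 < b ->
  log_integral (b * 2 ^+ J) <= log_integral b + 2 * dyadic_sum phi b J.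
Proof.
move=> b0; elim: J => [|J IH].
  by rewrite expr0 mulr1 /dyadic_sum big_ord0 mulr0 addr0.
rewrite dyadic_sum_recr (_ : b * 2 ^+ J.+1 = 2 * (b * 2 ^+ J)); last by rewrite exprS; ring.
have s0 : 0 < b * 2 ^+ J by rewrite mulr_gt0// exprn_gt0.
move: (b * 2 ^+ J) IH s0 => s IH s0.
have /andP[_ l] := log_integralB_bounds s (2 * s) (ltW s0) ltac:(lra).
suff : phi (2 * s) * (2 * s - s) / (1 + s ^+ 2) <= 2 * (phi (2 * s) / (2 * s)) by lra.
have ps : 0 < phi (2 * s) by apply: phi_gt0; lra.
have -> : 2 * (phi (2 * s) / (2 * s)) = phi (2 * s) / s by rewrite invfM; field; rewrite gt_eqF.
rewrite -mulrA ler_pM2l// ler_pdivrMr ?oneDsqr_gt0// [leRHS]mulrC ler_pdivlMr//.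
by rewrite (_ : (2 * s - s) * s = s ^+ 2) ?lerDr//; ring.
Qed.

(* Geometric decay of the terms: each is at most [2 ^ - eps] times the next. *)
Lemma dyadic_sum_rapid eps A : 0 < eps -> 0 < A ->
  (forall x y, A <= x -> x < y -> phi x / x `^ (1 + eps) < phi y / y `^ (1 + eps)) ->
  exists2 K, 0 < K & forall b J, A <= b -> (0 < J)%N ->
    dyadic_sum phi b J <= K * (phi (b * 2 ^+ J) / (b * 2 ^+ J)).
Proof.
move=> e0 A0 inc.
pose r : R := (2 `^ eps)^-1.
have p2 : 1 < 2 `^ eps :> R.
  by rewrite /powR gt_eqF// -[ltLHS]expR0 ltr_expR mulr_gt0// ln_gt0// ltr1n.
have r0 : 0 < r by rewrite invr_gt0; lra.
have r1 : r < 1 by rewrite invf_lt1//; lra.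
have step s : A <= s -> phi s / s <= r * (phi (2 * s) / (2 * s)).
  move=> As; have s0 : 0 < s by lra.
  have := inc s (2 * s) As ltac:(lra).
  have pD (x : R) : 0 < x -> x `^ (1 + eps) = x * x `^ eps.
    by move=> x0; rewrite powRD ?(gt_eqF x0) ?implybT// powRr1// ltW.
  rewrite powRM ?(ltW s0)// !pD// => /ltW h'.
  have pse : 0 < s `^ eps by rewrite powR_gt0.
  rewrite /r; move: (2 `^ eps) (s `^ eps) p2 pse h' => u v u1 v0 h'.
  have u0 : 0 < u by lra.
  have -> : phi s / s = (phi s / (s * v)) * v by field; rewrite (gt_eqF s0) (gt_eqF v0).
  have -> : u^-1 * (phi (2 * s) / (2 * s)) = (phi (2 * s) / (2 * u * (s * v))) * v.
    by field; rewrite (gt_eqF s0) (gt_eqF v0) (gt_eqF u0).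
  by rewrite ler_pM2r.
exists ((1 - r)^-1); first by rewrite invr_gt0 subr_gt0.
move=> b J Ab; have b0 : 0 < b by lra.
case: J => // J _; elim: J => [|J IH].
  rewrite /dyadic_sum big_ord1 ler_peMl//.
    by rewrite divr_ge0 ?mulr_ge0 ?exprn_ge0 ?(ltW b0)// ltW// phi_gt0// mulr_ge0 ?exprn_ge0 ?(ltW b0).
  by rewrite invf_ge1; lra.
rewrite dyadic_sum_recr (_ : b * 2 ^+ J.+2 = 2 * (b * 2 ^+ J.+1)); last by rewrite (exprS 2 J.+1); ring.
have As : A <= b * 2 ^+ J.+1 by rewrite (le_trans Ab)// ler_peMr ?exprn_ege1 ?ler1n// ltW.
move: (b * 2 ^+ J.+1) IH As => s IH As.
have st := step s As.
have q0 : 0 < (1 - r)^-1 by rewrite invr_gt0 subr_gt0.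
have qE : (1 - r)^-1 = r * (1 - r)^-1 + 1.
  by field; rewrite subr_eq0 gt_eqF.
move: (1 - r)^-1 q0 qE IH => q q0 qE IH.
set X := phi s / s in st IH; set Y := _ / (2 * s) in st *.
have : q * X <= q * (r * Y) by rewrite ler_pM2l.
have -> : q * Y = q * (r * Y) + Y by rewrite {1}qE; ring.
by lra.
Qed.

End IntegralComparison.

(** * Choice of scales and absorption of constants *)

Lemma leq_add3_split i j k n : (i + j + k <= n)%N -> [/\ i <= n, j <= n & k <= n]%N.
Proof. by move=> h; split; lia. Qed.

Lemma leq_quarter n : (8 <= n)%N -> (n <= 8 * (n %/ 4))%N.
Proof. by lia. Qed.

Section Assembly.
Context {R : realType}.
Variables (phi : R -> R) (p : \bar R).
Hypotheses (phi_cont : {within `[0, +oo[, continuous phi})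
  (phi_incr : forall x y : R, 0 <= x -> x < y -> phi x < phi y)
  (phi_pos : forall x : R, 0 <= x -> 0 < phi x)
  (phi_decay : forall k : nat, (fun t : R => t ^+ k / expR (phi `|t|)) @ +oo --> 0)
  (p1 : (1 <= p)%E).

Let W (t : R) := expR (phi `|t|).
Let cphi := continuous_comp_normr phi phi_cont.

Let mono (x y : R) : 0 <= x -> x <= y -> phi x <= phi y.
Proof. by move=> x0; rewrite le_eqVlt => /predU1P[->//|xy]; exact/ltW/phi_incr. Qed.

(** The base scale is chosen after [a], so that [a] is itself a dyadic scale while [b] stays in a
    window independent of [n]. *)
Lemma dyadic_decomposition (A a : R) : 0 < A -> 2 * A <= a ->
  exists b N, [/\ A <= b, b <= 2 * A & a = b * 2 ^+ N.+1].
Proof.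
move=> A0 Aa.
have [n an] : exists n, a < A * 2 ^+ n.+2.
  exists (Num.bound (a / A)).
  have aA : 0 <= a / A by rewrite divr_ge0//; lra.
  rewrite mulrC -ltr_pdivrMr//; apply: (lt_le_trans (archi_boundP aA)).
  rewrite -natrX ler_nat ltnW// (ltn_trans (ltn_expl _ (ltnSn 1)))//.
  by rewrite ltn_exp2l//; lia.
elim: n an => [|n IH] an.
  rewrite expr2 in an.
  by exists (a / 2), 0%N; split; rewrite ?expr1; lra.
have [/IH//|an'] := ltP a (A * 2 ^+ n.+2).
have e0 : 0 < 2 ^+ n.+2 :> R by rewrite exprn_gt0.
exists (a / 2 ^+ n.+2), n.+1; split.
- by rewrite ler_pdivlMr.
- rewrite ler_pdivrMr// ltW// (lt_le_trans an)//.
  by rewrite (exprS 2 n.+2) le_eqVlt; apply/orP; left; apply/eqP; ring.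
- by rewrite divfK// gt_eqF.
Qed.

Lemma eventually_large (X : R) : 0 <= X ->
  exists N : nat, forall (n : nat) (x : R), (N <= n)%N -> 0 <= x -> phi x = n%:R -> X <= x.
Proof.
move=> X0; exists (Num.bound (phi X)) => n x Nn x0 phix; rewrite leNgt; apply/negP => xX.
have := mono _ _ x0 (ltW xX); rewrite phix leNgt => /negP; apply.
by apply: (lt_le_trans (archi_boundP (ltW (phi_pos _ X0)))); rewrite ler_nat.
Qed.

(** At [a] this reads [a <= e^n], the hypothesis under which powers of [a] are absorbed in the
    extrapolation. *)
Lemma eventually_le_expR : exists2 T : R, 1 <= T & forall t, T <= t -> t <= expR (phi t).
Proof.
have /cvgrPdist_le/(_ 1 ltr01) [T0 [_ h]] := phi_decay 1.
exists (Num.max 1 (T0 + 1)); first by rewrite le_max lexx.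
move=> t; rewrite ge_max => /andP[t1 tT].
have := h t; rewrite /= sub0r normrN expr1 (ger0_norm (_ : 0 <= t)); last lra.
rewrite ger0_norm ?divr_ge0 ?expR_ge0//; last lra.
by rewrite ler_pdivrMr ?expR_gt0// mul1r; apply; lra.
Qed.

(** A positive lower bound and a finite upper bound keep [fine] and [ln] away from their default
    values. *)
Lemma ln_fine_bounds (l u : R) (E : \bar R) : 0 < l -> (l%:E <= E)%E -> (E <= u%:E)%E ->
  ln l <= ln (fine E) /\ ln (fine E) <= ln u.
Proof.
case: E => [x||]// l0; rewrite !lee_fin/= => lx xu.
by rewrite !ler_ln ?posrE//; lra.
Qed.

(** The prefactor depends on [b] only through [phi b <= phi (2 A)], so that one [k] serves for all
    [n]. *)
Lemma En_dyadic_lower (A : R) : 1 <= A ->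
  exists C k : R, [/\ 0 < C, 0 < k & exists N0 : nat,
    forall (n : nat) (b : R) (J : nat), (N0 <= n)%N -> 1 <= b -> b <= 2 * A -> (0 < J)%N ->
      phi (b * 2 ^+ J) = n%:R -> ((k * expR (- C * dyadic_sum phi b J))%:E <= En n p W)%E].
Proof.
move=> A1.
have [C C0 HC] := En_ge_dyadic phi cphi mono (phi_pos 0 (lexx 0)).
have [T T1 HT] := eventually_le_expR.
have [N0 HN] := eventually_large T ltac:(lra).
exists C, ((4 * (expR (phi (2 * A)) + 1))^-1); split => //.
exists N0.+1 => n b J Nn b1 bA J0 phia.
have a1 : 1 <= b * 2 ^+ J by rewrite (le_trans b1)// ler_peMr ?exprn_ege1 ?ler1n//; lra.
have Ta : T <= b * 2 ^+ J by apply: (HN n) => //; [exact: ltnW|lra].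
have aen : b * 2 ^+ J <= expR 1 ^+ n by rewrite -expRM_natl mulr1 -phia HT.
have b0 : 0 < b by lra.
have := HC p b J n p1 b0 (leq_trans (ltn0Sn _) Nn) J0 phia a1 aen.
apply: le_trans; rewrite lee_fin ler_pM2r ?expR_gt0//.
rewrite lef_pV2 ?posrE ?mulr_gt0 ?addr_gt0 ?expR_gt0// ler_pM2l// lerD2r ler_expR mono//.
by lra.
Qed.

Lemma rapid_ratio_large (eps A : R) : 0 < eps -> 0 < A ->
  (forall x y, A <= x -> x < y -> phi x / x `^ (1 + eps) < phi y / y `^ (1 + eps)) ->
  forall v : R, exists2 X, 0 <= X & forall x, X <= x -> v <= phi x / x.
Proof.
move=> e0 A0 inc v.
pose c := phi A / A `^ (1 + eps).
have c0 : 0 < c by rewrite divr_gt0 ?powR_gt0// phi_pos// ltW.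
pose u := Num.max v 0 / c.
have u0 : 0 <= u by rewrite divr_ge0 ?le_max ?lexx ?orbT// ltW.
exists (A + 1 + u `^ eps^-1); first by rewrite addr_ge0 ?powR_ge0//; lra.
move=> x; have := powR_ge0 u eps^-1 => pu ux.
have x0 : 0 < x by lra.
have := inc A x (lexx A) ltac:(lra); rewrite -/c => /ltW h.
have xe : u <= x `^ eps.
  rewrite -[leLHS]powRr1// -(@mulVf _ eps) ?gt_eqF// powRrM.
  by rewrite ge0_ler_powR ?nnegrE ?powR_ge0 ?ltW//; lra.
apply: (@le_trans _ _ (c * x `^ eps)).
  apply: (@le_trans _ _ (c * u)); last by rewrite ler_pM2l.
  by rewrite /u mulrC divfK ?gt_eqF// le_max lexx.
move: h; rewrite powRD ?(gt_eqF x0) ?implybT// powRr1 ?(ltW x0)//.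
have p0 : 0 < x `^ eps by rewrite powR_gt0.
by rewrite !ler_pdivlMr ?mulr_gt0// => h; rewrite mulrAC -mulrA.
Qed.

Lemma rapid_bounds : rapidly_growing phi ->
  exists c C : R, 0 < c /\ c <= C /\
    \forall n \near \oo, forall x : R, 0 <= x -> phi x = n%:R ->
      - C * (n%:R / x) <= ln (fine (En n p W)) /\
      ln (fine (En n p W)) <= - c * (n%:R / x).
Proof.
move=> [_ [eps [A0 [e0 [A00 inc]]]]].
pose A := Num.max A0 1.
have A1 : 1 <= A by rewrite le_max lexx orbT.
have AA0 : A0 <= A by rewrite le_max lexx.
have A_gt0 : 0 < A by lra.
have [C [k [C0 k0 [N0 HN0]]]] := En_dyadic_lower A A1.
have [K K0 HK] := dyadic_sum_rapid phi phi_pos eps A0 e0 A00 inc.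
have [B B0 HB] := weight_decay_bound phi phi_pos (phi_decay 4).
(* Thresholds for [n / x]: 16 makes [m / (2 x) >= 1], hence its exponential at least 2; the other
   two absorb [ln k] and [ln (16 B)]. *)
pose v := Num.max 16 (Num.max (- ln k) (32 * ln (16 * B))).
have [X X0 HX] := rapid_ratio_large eps A0 e0 A00 inc v.
have [N1 HN1] := eventually_large (X + 2 * A) ltac:(lra).
exists (32^-1), (C * K + 1 + 32^-1); split; [lra|split].
  by rewrite lerDr addr_ge0// mulr_ge0// ltW.
exists (N0 + N1 + 8)%N => // n /= /leq_add3_split[nN0 nN1 n8] x x0 phix.
have xbig : X + 2 * A <= x by exact: (HN1 n).
have x_gt0 : 0 < x by lra.
have nx : v <= n%:R / x by rewrite -phix HX//; lra.
have [b [N [Ab bA xE]]] := dyadic_decomposition A x A_gt0 ltac:(lra).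
have lower : ((k * expR (- C * dyadic_sum phi b N.+1))%:E <= En n p W)%E.
  by apply: HN0 => //; [lra|rewrite -xE].
(* From [n >= 8] follows [m >= n / 8], so the exponent is at least [n / (16 x)]; half of it absorbs
   [ln (16 B)], which leaves 1/32. *)
pose m := (n %/ 4)%N.
have m8 : n%:R <= 8 * m%:R :> R by rewrite -natrM ler_nat leq_quarter.
have v16 : 16 <= n%:R / x by apply: le_trans nx; rewrite le_max lexx.
have mx : n%:R / x / 16 <= m%:R / (2 * x).
  have -> : m%:R / (2 * x) = (8 * m%:R) / x / 16 by field; rewrite gt_eqF.
  by rewrite ler_pM2r ?invr_gt0// ler_pM2r ?invr_gt0.
have grow t : x <= t -> n%:R * (t / x) <= phi t.
  rewrite le_eqVlt => /predU1P[<-|xt]; first by rewrite divff ?gt_eqF// mulr1 phix.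
  have := inc x t ltac:(lra) xt; have t0 : 0 < t by lra.
  rewrite phix => /ltW; rewrite ler_pdivlMr ?powR_gt0// => h.
  have r1 : 1 <= (t / x) `^ eps.
    have tx1 : 1 <= t / x by rewrite ler_pdivlMr ?mul1r ?ltW.
    by rewrite -[leLHS](powRr0 (t / x)); apply: ler_powR => //; exact: ltW.
  have tx0 : 0 < t / x by rewrite divr_gt0.
  have e1 : t `^ (1 + eps) = (t / x) `^ (1 + eps) * x `^ (1 + eps).
    by rewrite -powRM ?divfK ?gt_eqF// ltW.
  have e2 : (t / x) `^ (1 + eps) = (t / x) * (t / x) `^ eps.
    by rewrite powRD ?(gt_eqF tx0) ?implybT// powRr1// ltW.
  have px : 0 < x `^ (1 + eps) by rewrite powR_gt0.
  have {}h : n%:R * ((t / x) * (t / x) `^ eps) <= phi t.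
    rewrite -e2; apply: le_trans h; rewrite e1.
    by rewrite [leRHS]mulrACA mulVf ?mulr1// gt_eqF.
  by apply: le_trans h; rewrite ler_wpM2l// ler_peMr ?(ltW tx0)//.
have upper : (En n p W <= (16 * B * expR (- (m%:R / (2 * x))))%:E)%E.
  have x1 : 1 <= x by lra.
  have m4 : (4 * m <= n)%N by rewrite mulnC leq_divM.
  have em2 : 2 <= expR (m%:R / (2 * x)).
    by apply: (le_trans expR1_ge2); rewrite ler_expR; lra.
  exact: (En_le_chebyshev phi cphi phi_pos B x m n p p1 B0 HB x1 m4 grow em2).
have [h1 h2] := ln_fine_bounds _ _ _ (mulr_gt0 k0 (expR_gt0 _)) lower upper.
rewrite lnM ?posrE ?expR_gt0// expRK in h1.
rewrite lnM ?posrE ?mulr_gt0 ?expR_gt0// expRK in h2.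
have Sle : dyadic_sum phi b N.+1 <= K * (n%:R / x).
  by rewrite -phix xE; apply: HK => //; lra.
have CS : C * dyadic_sum phi b N.+1 <= C * (K * (n%:R / x)) by rewrite ler_pM2l.
have vk : - ln k <= n%:R / x by apply: le_trans nx; rewrite !le_max lexx orbT.
have vB : 32 * ln (16 * B) <= n%:R / x by apply: le_trans nx; rewrite !le_max lexx !orbT.
by split; lra.
Qed.

Lemma normal_bounds : normally_growing phi ->
  exists c C : R, 0 < c /\ c <= C /\
    \forall n \near \oo, forall x : R, 0 <= x -> phi x = n%:R ->
      - C * log_integral phi x <= ln (fine (En n p W)) /\
      ln (fine (En n p W)) <= - c * log_integral phi x.
Proof.
move=> [[_ [_ Ioo]] [A0 [A00 [dec cvx]]]].
pose A := Num.max A0 1.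
have A1 : 1 <= A by rewrite le_max lexx orbT.
have AA0 : A0 <= A by rewrite le_max lexx.
have A_gt0 : 0 < A by lra.
have quad x y : A <= x -> x <= y -> phi y * x ^+ 2 <= phi x * y ^+ 2.
  move=> Ax xy; have := dec x y ltac:(lra) xy.
  have x0 : 0 < x ^+ 2 by rewrite exprn_gt0//; lra.
  have y0 : 0 < y ^+ 2 by rewrite exprn_gt0//; lra.
  by rewrite ler_pdivrMr// mulrAC ler_pdivlMr.
have mid x : A <= x -> 2 * phi (2 * x) <= phi x + phi (2 * (2 * x)).
  by move=> Ax; apply: (convex_log_mid _ _ _ A00 cvx); lra.
have ext x t : A <= x -> 2 * x <= t ->
    (phi (2 * x) - phi x) * ln (t / (2 * x)) <= phi t - phi (2 * x).
  by move=> Ax; apply: (convex_log_ext _ _ _ _ A00 mono cvx); lra.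
have [C [k [C0 k0 [N0 HN0]]]] := En_dyadic_lower A A1.
have [B B0 HB] := weight_decay_bound phi phi_pos (phi_decay 4).
pose M := expR (phi (2 * A) / 2).
have M0 : 0 < M by exact: expR_gt0.
pose I0 := log_integral phi (2 * A).
(* The minorant gives [S / 112] up to constants, and [S >= (I - I0) / 2] for the logarithmic
   integral [I], so the logarithm of the error is at most [K1 - I / 224]. The threshold
   [448 K1 <= I] leaves [- I / 448]. *)
pose K1 := ln (4 * (M * B)) + (phi (4 * A) / 28 + 1) / 2 + I0 / 224.
pose v := Num.max (- ln k) (448 * K1).
have [X X0 HX] := log_integral_unbounded phi cphi mono phi_pos Ioo (Num.max v 0).
have [N1 HN1] := eventually_large (X + 2 * A) ltac:(lra).
exists (448^-1), (16 * C + 1 + 448^-1); split; [lra|split].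
  by rewrite lerDr addr_ge0// mulr_ge0// ltW.
exists (N0 + N1 + 0)%N => // n /= /leq_add3_split[nN0 nN1 _] x x0 phix.
have xbig : X + 2 * A <= x by exact: (HN1 n).
have Iv : Num.max v 0 <= log_integral phi x by apply: HX; lra.
have [b [N [Ab bA xE]]] := dyadic_decomposition A x A_gt0 ltac:(lra).
have b0 : 0 < b by lra.
have lower : ((k * expR (- C * dyadic_sum phi b N.+1))%:E <= En n p W)%E.
  by apply: HN0 => //; [lra|rewrite -xE].
have phia : phi (b * 2 ^+ N.+1) = n%:R by rewrite -xE.
have [P [sP Pt Pi]] := normal_minorant phi A b N n mono phi_pos A1 quad mid ext Ab phia.
set S := dyadic_sum phi b N.+1 in lower Pi *.
have c0 : 0 < cabs P.['i%C] by apply: lt_le_trans Pi; exact: expR_gt0.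
have Pi0 : P.['i%C] != 0 by rewrite -cabs_eq0 gt_eqF.
have Pt' t : cabs P.[(t%:C)%C] <= M * expR (phi `|t| / 2).
  apply: (le_trans (Pt t)); rewrite ler_pM2r ?expR_gt0// ler_expR ler_pM2r// mono//.
  exact: ltW.
have upper := En_le_of_half_weight phi cphi B M P n p p1 B0 M0 HB sP Pi0 Pt'.
have [h1 h2] := ln_fine_bounds _ _ _ (mulr_gt0 k0 (expR_gt0 _)) lower upper.
rewrite lnM ?posrE ?expR_gt0// expRK in h1.
rewrite mulrA ln_div ?posrE ?mulr_gt0// in h2.
have lnP : (S / 56 - phi (2 * b) / 28 - 1) / 2 <= ln (cabs P.['i%C]).
  by rewrite -[leLHS]expRK ler_ln ?posrE ?expR_gt0.
have p4 : phi (2 * b) <= phi (4 * A) by rewrite mono//; lra.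
have dbl y : b <= y -> phi (2 * y) <= 4 * phi y.
  by move=> yb; apply: (doubling phi A A1 quad); lra.
have S1 : S <= 16 * log_integral phi x.
  by rewrite xE; apply: dyadic_sum_le_log_integral => //; lra.
have S2 : log_integral phi x <= I0 + 2 * S.
  rewrite xE; apply: (le_trans (log_integral_le_dyadic_sum phi cphi mono phi_pos b N.+1 b0)).
  by rewrite lerD2r; apply: ler_log_integral => //; exact: ltW.
have CS : C * S <= C * (16 * log_integral phi x) by rewrite ler_pM2l.
have Iv0 : v <= log_integral phi x by apply: le_trans Iv; rewrite le_max lexx.
have vk : - ln k <= log_integral phi x by apply: le_trans Iv0; rewrite le_max lexx.
have vB : 448 * K1 <= log_integral phi x by apply: le_trans Iv0; rewrite le_max lexx orbT.
have I_ge0 : 0 <= log_integral phi x by apply: le_trans Iv; rewrite le_max lexx orbT.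
by split; [lra|rewrite /K1 in vB; lra].
Qed.

End Assembly.

Theorem theorem3 (R : realType) (phi : R -> R) (p : \bar R)
  (phi_cont : {within `[0, +oo[, continuous phi})
  (phi_incr : forall x y : R, 0 <= x -> x < y -> phi x < phi y)
  (phi_pos : forall x : R, 0 <= x -> 0 < phi x)
  (phi_decay : forall k : nat,
     (fun t : R => t ^+ k / expR (phi `|t|)) @ +oo --> 0 /\
     (fun t : R => t ^+ k / expR (phi `|t|)) @ -oo --> 0)
  (phi_reg : regularly_growing phi)
  (hp : (1 <= p)%E) :
  (rapidly_growing phi ->
   exists c C : R, 0 < c /\ c <= C /\
     \forall n \near \oo, forall x : R, 0 <= x -> phi x = n%:R ->
       - C * (n%:R / x) <= ln (fine (En n p (fun t => expR (phi `|t|)))) /\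
       ln (fine (En n p (fun t => expR (phi `|t|)))) <= - c * (n%:R / x)) /\
  (normally_growing phi ->
   exists c C : R, 0 < c /\ c <= C /\
     \forall n \near \oo, forall x : R, 0 <= x -> phi x = n%:R ->
       - C * (\int[@lebesgue_measure R]_(t in `[0, x]) (phi t / (t ^+ 2 + 1)))%R
         <= ln (fine (En n p (fun t => expR (phi `|t|)))) /\
       ln (fine (En n p (fun t => expR (phi `|t|))))
         <= - c * (\int[@lebesgue_measure R]_(t in `[0, x]) (phi t / (t ^+ 2 + 1)))%R).
Proof.
have decay k := (phi_decay k).1.
split; first exact: rapid_bounds.
exact: normal_bounds.
Qed.
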